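(* Let $Y$ be an intensity-reweighted moment stationary (IRMS) spatio-temporal point process on $\mathbb{R}^d\times\mathbb{R}$, and let $r,t\ge 0$ be such that $J_{\rm inhom}(r,t)$ is defined (i.e. its defining series converges absolutely) and \[ \limsup_{n\to\infty}\left(\frac{\bar\lambda^n}{n!}\int_{S_r^t}\cdots\int_{S_r^t}\frac{\rho^{(n)}((x_1,t_1),\ldots,(x_n,t_n))}{\lambda(x_1,t_1)\cdots\lambda(x_n,t_n)}\prod_{i=1}^n dx_i\,dt_i\right)^{1/n}<1 . \] For $y=(a,b)\in\mathbb{R}^d\times\mathbb{R}$ put \[ u_{r,t}^{y}(x,s)=\frac{\bar\lambda\,\mathbf 1\{\|a-x\|\le r,\ |b-s|\le t\}}{\lambda(x,s)}, \] \[ G_{\rm inhom}(r,t)=1-G^{!y}(1-u_{r,t}^{y})=1-\mathbb{E}^{!(a,b)}\Big[\prod_{(x,s)\in Y}\big(1-u^y_{r,t}(x,s)\big)\Big], \] \[ F_{\rm inhom}(r,t)=1-G(1-u_{r,t}^{y})=1-\mathbb{E}\Big[\prod_{(x,s)\in Y}\big(1-u^y_{r,t}(x,s)\big)\Big]. \] Then $G_{\rm inhom}(r,t)$ and $F_{\rm inhom}(r,t)$ are $\ell$-almost everywhere constant with respect to $y=(a,b)\in\mathbb{R}^d\times\mathbb{R}$, and \[ J_{\rm inhom}(r,t)=\frac{1-G_{\rm inhom}(r,t)}{1-F_{\rm inhom}(r,t)} \] whenever $F_{\rm inhom}(r,t)\ne 1$ (with $G_{\rm inhom}(r,t)$, $F_{\rm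 inhom}(r,t)$ denoting these almost everywhere constant values).
   Context: Let $d\ge1$; $\|\cdot\|$ is the Euclidean norm on $\mathbb{R}^d$, $\ell$ is Lebesgue measure on $\mathbb{R}^d\times\mathbb{R}$, and $S_r^t=\{(x,s)\in\mathbb{R}^d\times\mathbb{R}:\|x\|\le r,\ |s|\le t\}$. $N$ is the space of locally finite counting measures on $\mathbb{R}^d\times\mathbb{R}$ with the $\sigma$-algebra generated by the maps $\varphi\mapsto\varphi(A)$, $A$ Borel. A spatio-temporal point process (STPP) $Y$ is a random element of $N$ that is almost surely simple; it is identified with its random set of points. $P$ is its distribution. Product densities: $\rho^{(n)}$, $n\ge1$, are the permutation-invariant densities of the (locally finite) factorial moment measures of $Y$ with respect to the $n$-fold product of $\ell$: for all measurable $h\ge0$, $\mathbb{E}[\sum^{\neq}_{y_1,\ldots,y_n\in Y}h(y_1,\ldots,y_n)]=\int\cdots\int h\,\rho^{(n)}\,dy_1\cdots dy_n$, the sum being over $n$-tuples of pairwise distinct points of $Y$. The intensity function is $\lambda(x,t)=\rho^{(1)}(x,t)$, and $\bar\lambda=\inf_{(x,t)}\lambda(x,t)$. $n$-point correlation functions: $\xi_1\equiv1$ and, recursively in $n$, $\dfrac{\rho^{(n)}(y_1,\ldots,y_n)}{\prod_{k=1}^n\lambda(y_k)}=\sum_{k=1}^n\sum_{D_1,\ldots,D_k}\prod_{j=1}^k\xi_{|D_j|}(\{y_i:i\in D_j\})$, where the inner sum is over all partitions of $\{1,\ldots,n\}$ into $k$ non-empty sets $D_1,\ldots,D_k$. IRMS: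 $Y$ is intensity-reweighted moment stationary if product densities of all orders exist, $\bar\lambda>0$, and for every $n\ge1$, $\xi_n(y_1+c,\ldots,y_n+c)=\xi_n(y_1,\ldots,y_n)$ for almost all $y_1,\ldots,y_n\in\mathbb{R}^d\times\mathbb{R}$ and all $c\in\mathbb{R}^d\times\mathbb{R}$. Translation-invariant versions of $\xi_n$ are used when evaluating with one argument equal to the origin $(0,0)$. Inhomogeneous $J$-function of an IRMS STPP: $J_n(r,t)=\int_{S_r^t}\cdots\int_{S_r^t}\xi_{n+1}((0,0),(x_1,t_1),\ldots,(x_n,t_n))\prod_{i=1}^n dx_i\,dt_i$ and $J_{\rm inhom}(r,t)=1+\sum_{n=1}^\infty\frac{(-\bar\lambda)^n}{n!}J_n(r,t)$, for all $r,t\ge0$ for which the series is absolutely convergent. Reduced Palm distributions $P^{!(x,t)}$ (with expectation $\mathbb{E}^{!(x,t)}$) are the probability measures on $N$, measurable in $(x,t)$, satisfying $\mathbb{E}[\sum_{(x,t)\in Y}g(x,t,Y\setminus\{(x,t)\})]=\int_{\mathbb{R}^d\times\mathbb{R}}\mathbb{E}^{!(x,t)}[g(x,t,Y)]\lambda(x,t)\,dx\,dt$ for all measurable $g\ge0$. Generating functional: $G(v)=\mathbb{E}[\prod_{(x,t)\in Y}v(x,t)]$ for $v=1-u$ with $u:\mathbb{R}^d\times\mathbb{R}\to[0,1]$ measurable with bounded support (empty products equal $1$); $G^{!y}$ is the generating functional of $P^{!y}$. *)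

(* Defs.v *)
From HB Require Import structures.
From mathcomp Require Import all_boot all_order all_algebra fingroup perm.
From mathcomp Require Import all_classical all_reals all_analysis.
From mathcomp Require Import measurable_realfun.

Set Implicit Arguments.
Unset Strict Implicit.
Unset Printing Implicit Defensive.
Import Order.TTheory GRing.Theory Num.Theory.
Import numFieldNormedType.Exports.

Local Open Scope classical_set_scope.
Local Open Scope ring_scope.

Section prod_measure.
Context d1 d2 (T1 : measurableType d1) (T2 : measurableType d2) (R : realType).
Variable m1 : {sigma_finite_measure set T1 -> \bar R}.
Variable m2 : {sigma_finite_measure set T2 -> \bar R}.

Lemma prod_measure_sigma_finite : sigma_finite setT (m1 \x m2)%E.
Proof.
have /sigma_finiteP[F [TF ndF Foo]] := sigma_finiteT m1.
have /sigma_finiteP[G [TG ndG Goo]] := sigma_finiteT m2.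
exists (fun n => F n `*` G n).
  rewrite -setXTT TF TG predeqE => -[x y]; split.
    move=> [/= [n _ Fnx] [k _ Gky]]; exists (maxn n k) => //; split.
    - by move: x Fnx; exact/subsetPset/ndF/leq_maxl.
    - by move: y Gky; exact/subsetPset/ndG/leq_maxr.
  by move=> [n _ []/= ? ?]; split; exists n.
move=> k; have [? ?] := Foo k; have [? ?] := Goo k.
split; first exact: measurableX.
by rewrite product_measure1E// lte_mul_pinfty// ge0_fin_numE.
Qed.

(* m1 \x m2 as a sigma-finite measure; the library's own canonical instance
   only fires when m1 and m2 are subprobabilities. *)
Definition prod_measure : {sigma_finite_measure set (T1 * T2)%type -> \bar R} :=
  HB.pack (m1 \x m2)%E
    (Measure_isSigmaFinite.Build _ _ _ (m1 \x m2)%E prod_measure_sigma_finite).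

End prod_measure.

Section power_measure.
Context dd (T : measurableType dd) (R : realType).
Variable mu : {sigma_finite_measure set T -> \bar R}.

Section cons_measure.
Variables (n : nat) (m : {sigma_finite_measure set (n.-tuple T) -> \bar R}).

Definition tcons (p : T * n.-tuple T) : n.+1.-tuple T := [tuple of p.1 :: p.2].

Definition cons_measure : set (n.+1.-tuple T) -> \bar R :=
  pushforward (prod_measure mu m) tcons.

Lemma measurable_tcons : measurable_fun [set: T * n.-tuple T] tcons.
Proof. exact: (measurable_cons measurable_fst measurable_snd). Qed.

Let cons_measure0 : cons_measure set0 = 0%E.
Proof. by rewrite /cons_measure /pushforward preimage_set0 measure0. Qed.

Let cons_measure_ge0 A : (0 <= cons_measure A)%E.
Proof. exact: (measure_ge0 (prod_measure mu m)). Qed.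

Let cons_measure_sigma_additive : semi_sigma_additive cons_measure.
Proof.
move=> F mF tF mUF; rewrite /cons_measure /pushforward preimage_bigcup.
have mtF k : measurable (tcons @^-1` F k).
  by rewrite -[X in measurable X]setTI; exact: measurable_tcons.
apply: measure_semi_sigma_additive => //; last exact: bigcupT_measurable.
apply/trivIsetP => i j _ _ ij; rewrite -preimage_setI.
by move/trivIsetP : tF => /(_ _ _ _ _ ij) ->//; rewrite preimage_set0.
Qed.

HB.instance Definition _ := isMeasure.Build _ _ _ cons_measure
  cons_measure0 cons_measure_ge0 cons_measure_sigma_additive.

Let cons_measure_sigma_finite : sigma_finite setT cons_measure.
Proof.
have [F FT Foo] := sigma_finiteT (prod_measure mu m).
pose uncons (v : n.+1.-tuple T) := (thead v, [tuple of behead v]).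
have unconsK v : tcons (uncons v) = v by rewrite [RHS]tuple_eta.
have tconsK p : uncons (tcons p) = p.
  by case: p => x v; congr pair; apply: val_inj.
have muncons : measurable_fun setT uncons.
  apply: measurable_fun_pair; last exact: measurable_behead.
  exact: measurable_tnth.
exists (fun k => uncons @^-1` F k) => [|k].
  by rewrite -preimage_bigcup -FT preimage_setT.
have [mF Fk] := Foo k; split.
  by rewrite -[X in measurable X]setTI; exact: muncons.
rewrite /cons_measure /pushforward -comp_preimage.
by rewrite (_ : uncons \o tcons = id)//; apply/funext.
Qed.

HB.instance Definition _ := Measure_isSigmaFinite.Build _ _ _ cons_measure
  cons_measure_sigma_finite.

End cons_measure.

(* The n-fold product measure of mu on n-tuples. *)
Fixpoint power_measure n : {sigma_finite_measure set (n.-tuple T) -> \bar R} :=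
  match n with
  | 0 => \d_([tuple] : 0.-tuple T)
  | k.+1 => cons_measure (power_measure k)
  end.

End power_measure.

(* R^d * R, where R^d is the type of d-tuples with its product
   (i.e. Borel) sigma-algebra. *)
Notation stpoint R d :=
  ((d.-tuple (measurableTypeR R)) * (measurableTypeR R))%type.

Section space_time.
Context {R : realType} {d : nat}.
Implicit Types y z c : stpoint R d.

Definition leb : {sigma_finite_measure set (stpoint R d) -> \bar R} :=
  prod_measure (power_measure (@lebesgue_measure R) d) (@lebesgue_measure R).

Definition origin : stpoint R d := ([tuple (0 : R) | _ < d], (0 : R)).

Definition padd y c : stpoint R d :=
  ([tuple ((tnth y.1 i : R) + tnth c.1 i) | i < d], (y.2 : R) + c.2).

Definition psub y z : stpoint R d :=
  ([tuple ((tnth y.1 i : R) - tnth z.1 i) | i < d], (y.2 : R) - z.2).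

Definition enorm (x : d.-tuple (measurableTypeR R)) : R :=
  Num.sqrt (\sum_(i < d) (tnth x i : R) ^+ 2).

Definition cyl (r t : R) : set (stpoint R d) :=
  [set y | enorm y.1 <= r /\ `|y.2 : R| <= t].

Definition bounded (A : set (stpoint R d)) := exists M : R, A `<=` cyl M M.

Definition tpow n (A : set (stpoint R d)) : set (n.-tuple (stpoint R d)) :=
  [set v | forall i, A (tnth v i)].

Definition tshift n (v : n.-tuple (stpoint R d)) c : n.-tuple (stpoint R d) :=
  [tuple padd (tnth v i) c | i < n].

End space_time.

(* Integrality is only required on bounded Borel sets: on every other Borel set
   the value is then a natural number or +oo by sigma-additivity. *)
Record config (R : realType) (d : nat) := Config {
  config_measure :> {measure set (stpoint R d) -> \bar R} ;
  config_lf : forall A, measurable A -> bounded A ->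
    exists k : nat, config_measure A = (k%:R)%:E }.

Section config_measurable.
Context (R : realType) (d : nat).

Let mzero_lf (A : set (stpoint R d)) : measurable A -> bounded A ->
  exists k : nat, (mzero : {measure set (stpoint R d) -> \bar R}) A = (k%:R)%:E.
Proof. by exists 0%N. Qed.

HB.instance Definition _ := gen_eqMixin (config R d).
HB.instance Definition _ := gen_choiceMixin (config R d).
HB.instance Definition _ := isPointed.Build (config R d) (Config mzero_lf).

Definition config_evals : set (set (config R d)) :=
  [set U | exists2 A : set (stpoint R d), measurable A &
           exists2 B : set (\bar R), measurable B &
           U = [set phi : config R d | B (phi A)]].

Definition config_display : measure_display.
Proof. by constructor. Qed.

Let config_measurable0 : <<s config_evals >> set0.
Proof. exact: sigma_algebra0. Qed.

Let config_measurableC U : <<s config_evals >> U -> <<s config_evals >> (~` U).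
Proof. exact: sigma_algebraC. Qed.

Let config_measurableU (F : (set (config R d))^nat) :
  (forall i, <<s config_evals >> (F i)) -> <<s config_evals >> (\bigcup_i F i).
Proof. exact: sigma_algebra_bigcup. Qed.

HB.instance Definition _ := @isMeasurable.Build config_display (config R d)
  <<s config_evals >> config_measurable0 config_measurableC config_measurableU.

End config_measurable.

Section configurations.
Context {R : realType} {d : nat}.
Implicit Types phi : config R d.

Definition simple_config phi := forall y, (phi [set y] <= 1)%E.

Definition atoms phi : set (stpoint R d) := [set y | (0 < phi [set y])%E].

(* Y \ {y} for Y = phi: phi restricted to the complement of {y}. *)
Section remove_point.
Variables (phi : config R d) (y : stpoint R d).

Lemma measurable_pointC : measurable (~` [set y]).
Proof.
apply: measurableC; rewrite (_ : [set y] = [set y.1] `*` [set y.2]); last first.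
  by apply/seteqP; case: y => a b; split=> [[? ?] [-> ->]|[? ?] [/= -> ->]].
apply: measurableX; last exact: measurable_set1.
rewrite (_ : [set y.1] =
    \bigcap_(i in [set: 'I_d]) ((fun x => tnth x i) @^-1` [set tnth y.1 i])).
  apply: fin_bigcap_measurable => // i _; rewrite -[X in measurable X]setTI.
  by apply: measurable_tnth => //; exact: measurable_set1.
apply/seteqP; split => [x -> i _ //|x /= xy].
by apply/eq_from_tnth => i; exact: xy.
Qed.

Let remove_lf A : measurable A -> bounded A ->
  exists k : nat, mrestr phi measurable_pointC A = (k%:R)%:E.
Proof.
move=> mA [M AM]; rewrite /mrestr; apply: config_lf.
  by apply: measurableI => //; exact: measurable_pointC.
by exists M; apply: subset_trans AM; exact: subIsetl.
Qed.

Definition remove_point : config R d := Config remove_lf.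

End remove_point.

Definition distinct_tuples n phi : set (n.-tuple (stpoint R d)) :=
  [set v : n.-tuple (stpoint R d) | uniq v /\ tpow (atoms phi) v].

(* The product over a set of points is that of its factors different from 1;
   there are finitely many of them when 1 - v has bounded support. *)
Definition point_prod (v : stpoint R d -> R) phi : R :=
  \big[*%R/1]_(y \in atoms phi) v y.

End configurations.

Arguments distinct_tuples {R d} n phi.

Section point_processes.
Context {R : realType} {d : nat} {dO : measure_display}
  {Omega : measurableType dO}.
Variable Pr : probability Omega R.
Local Open Scope ereal_scope.

Definition STPP (Y : {RV Pr >-> config R d}) :=
  {ae Pr, forall w, simple_config (Y w)}.

Definition factorial_moment (Y : {RV Pr >-> config R d}) n
    (A : set (n.-tuple (stpoint R d))) : \bar R :=
  \int[Pr]_w (\esum_(v in distinct_tuples n (Y w)) (\1_A v)%:E).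

Definition product_density (Y : {RV Pr >-> config R d}) n
    (rho : n.-tuple (stpoint R d) -> R) :=
  [/\ measurable_fun setT rho,
      forall v, (0 <= rho v)%R,
      forall (s : 'S_n) v, rho [tuple tnth v (s i) | i < n] = rho v,
      forall A, measurable A -> bounded A ->
        factorial_moment Y (tpow A : set (n.-tuple _)) < +oo &
      forall h : n.-tuple (stpoint R d) -> \bar R,
        measurable_fun setT h -> (forall v, 0 <= h v) ->
        \int[Pr]_w (\esum_(v in distinct_tuples n (Y w)) h v) =
        \int[power_measure leb n]_v (h v * (rho v)%:E)].

Definition product_densities (Y : {RV Pr >-> config R d})
    (rho : forall n, n.-tuple (stpoint R d) -> R) :=
  forall n, (0 < n)%N -> product_density Y (rho n).

End point_processes.

Section correlation.
Context {R : realType} {d : nat}.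
Implicit Types (rho xi : forall n, n.-tuple (stpoint R d) -> R).

Definition intensity rho (y : stpoint R d) : R := rho 1 [tuple y].

Definition lambda_bar rho : R := inf (range (intensity rho)).

Definition reweighted_density rho n (v : n.-tuple (stpoint R d)) : R :=
  rho n v / \prod_(i < n) intensity rho (tnth v i).

Definition subtuple n (v : n.-tuple (stpoint R d)) (D : {set 'I_n}) :
  #|D|.-tuple (stpoint R d) := [tuple tnth v (enum_val i) | i < #|D|].

(* These equations determine xi n, n >= 1, since the partition into one block
   contributes xi n v. *)
Definition correlation_functions rho xi :=
  (forall v, xi 1 v = 1) /\
  forall n (v : n.-tuple (stpoint R d)), (0 < n)%N ->
    reweighted_density rho v =
    \sum_(1 <= k < n.+1)
      \sum_(P : {set {set 'I_n}} |
             finset.partition P [set: 'I_n] && (#|P| == k))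
        \prod_(D in P) xi #|D| (subtuple v D).

Definition shift_invariant_ae xi := forall n, (0 < n)%N ->
  forall c, {ae power_measure leb n, forall v, xi n (tshift v c) = xi n v}.

Definition invariant_version xi xi' := forall n, (0 < n)%N ->
  [/\ measurable_fun setT (xi' n),
      forall v c, xi' n (tshift v c) = xi' n v &
      {ae power_measure leb n, forall v, xi' n v = xi n v}].

End correlation.

Definition IRMS (R : realType) (d : nat) (dO : measure_display)
    (Omega : measurableType dO) (Pr : probability Omega R)
    (Y : {RV Pr >-> config R d})
    (rho xi : forall n, n.-tuple (stpoint R d) -> R) :=
  [/\ product_densities Y rho, correlation_functions rho xi,
      0 < lambda_bar rho & shift_invariant_ae xi].

(* In the J-function xi is meant to be translation invariant everywhere, as its
   value at the single origin matters. *)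
Section J_function.
Context {R : realType} {d : nat}.
Implicit Types (rho xi : forall n, n.-tuple (stpoint R d) -> R).

Definition J_ xi (n : nat) (r t : R) : R :=
  \int[power_measure leb n]_(v in tpow (cyl r t))
    xi n.+1 [tuple of origin :: v].

Definition J_term rho xi (r t : R) : R^nat :=
  fun k => (- lambda_bar rho) ^+ k.+1 / (k.+1)`!%:R * J_ xi k.+1 r t.

Definition J_defined rho xi (r t : R) :=
  cvgn [normed series (J_term rho xi r t)].

Definition J_inhom rho xi (r t : R) : R :=
  1 + limn (series (J_term rho xi r t)).

End J_function.

Section G_F_functions.
Context {R : realType} {d : nat}.

(* That Palm y is a probability measure, measurable in y, is part of the type of
   the kernel Palm. *)
Definition reduced_palm (dO : measure_display) (Omega : measurableType dO)
    (Pr : probability Omega R) (Y : {RV Pr >-> config R d})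
    (lambda : stpoint R d -> R)
    (Palm : R.-pker (stpoint R d) ~> (config R d)) :=
  forall g : stpoint R d * config R d -> \bar R,
    measurable_fun setT g -> (forall p, (0 <= g p)%E) ->
    (\int[Pr]_w (\esum_(y in atoms (Y w)) g (y, remove_point (Y w) y)) =
     \int[leb]_y ((\int[Palm y]_phi g (y, phi)) * (lambda y)%:E))%E.

Definition generating_functional (Q : {measure set (config R d) -> \bar R})
  (v : stpoint R d -> R) : R := \int[Q]_phi point_prod v phi.

Implicit Types rho : forall n, n.-tuple (stpoint R d) -> R.

Definition u_fun rho (r t : R) (y z : stpoint R d) : R :=
  lambda_bar rho * \1_(cyl r t) (psub y z) / intensity rho z.

Definition G_inhom rho (Palm : R.-pker (stpoint R d) ~> (config R d)) (r t : R)
    (y : stpoint R d) : R :=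
  1 - generating_functional (Palm y) (fun z => 1 - u_fun rho r t y z).

Definition F_inhom rho (dO : measure_display) (Omega : measurableType dO)
    (Pr : probability Omega R) (Y : {RV Pr >-> config R d}) (r t : R)
    (y : stpoint R d) : R :=
  1 - generating_functional (distribution Pr Y)
        (fun z => 1 - u_fun rho r t y z).

End G_F_functions.

(* Main.v *)
From HB Require Import structures.
Require Import Defs.
From mathcomp Require Import all_boot all_order all_algebra finmap.
From mathcomp Require Import all_classical all_reals all_analysis.
From mathcomp Require Import measurable_realfun.
From mathcomp Require Import ring lra.

(** Why the theorem holds.

    Let S be the cylinder cyl r t.  On a bounded set a configuration has finitely
    many points, so for u = u_fun rho r t y the product of the 1 - u z over its
    points is the finite alternating sum, over n, of (-1)^n / n! times the sum of
    u z_1 ... u z_n over the n-tuples of distinct points ([tuple_sum_coef],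
    [point_prod_series]).  As soon as the expectations m_n of these tuple sums
    have a convergent series m_n / n!, dominated convergence gives the generating
    functional as the alternating series ([generating_functional_series]).

    Under the law of Y, m_n is the integral of the n-th product density against
    the n-fold product of u; under the reduced Palm distribution at y it is the
    integral of the (n+1)-st product density, with first argument y, divided by
    the intensity at y ([tuple_sum_moment], [palm_moment]).  Because u is
    lambda_bar / lambda on the window y + S, only reweighted densities appear.
    They equal, almost everywhere, the sum over set partitions of the products of
    the functions xi' over the blocks ([correlation_psum], [reweighted_psum_ae]),
    which is invariant under translations.  Hence the window can be moved to the
    origin: m_n is lambda_bar^n I_n for every y ([tuple_sum_window]), respectively
    lambda_bar^n K_n for almost every y ([tuple_sum_palm]), where I_n and K_n are
    [window_mass] and [palm_mass].  Once
    their series converge, F and G are constant.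

    Classifying the partitions that enter K_n by the block of the origin, and
    splitting the integral over S^n along the coordinates of that block
    ([Rintegral_mask]), gives K_n = sum_k 'C(n, k) J_k I_(n - k)
    ([palm_mass_expansion]).  So K_n / n! is the Cauchy product of J_k / k! and
    I_k / k!.  The series of the latter converges absolutely by the root test, that
    of the former by assumption, and the alternating series of the product is the
    product of the alternating series: 1 - G = J (1 - F).

    The tuple sums must be measurable functions of the configuration for these
    expectations to be exchanged with series.  This rests on the fact that an
    integer-valued measure is purely atomic ([charged_atom]): a sum over the atoms
    is then an integral against the configuration itself, with the multiplicities
    divided out ([esum_atoms], [measurable_esum_tuples]). *)

Set Implicit Arguments.
Unset Strict Implicit.
Unset Printing Implicit Defensive.
Import Order.TTheory GRing.Theory Num.Theory.
Import numFieldNormedType.Exports.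

Local Open Scope classical_set_scope.
Local Open Scope ring_scope.

(** * Bounded sets of space-time *)

Lemma measurable_slice d1 d2 d3 (X : measurableType d1) (Z : measurableType d2)
    (V : measurableType d3) (g : X * Z -> V) x :
  measurable_fun setT g -> measurable_fun setT (fun z => g (x, z)).
Proof.
move=> mg; apply: (measurableT_comp mg).
by apply: measurable_fun_pair; [exact: measurable_cst|exact: measurable_id].
Qed.

Section bounded_sets.
Context {R : realType} {d : nat}.
Implicit Types (M : R) (y z : stpoint R d).

Lemma ler_coord_enorm (x : d.-tuple (measurableTypeR R)) (i : 'I_d) :
  `|tnth x i : R| <= enorm x.
Proof.
rewrite /enorm -[leLHS]sqrtr_sqr ler_sqrt.
  rewrite [leRHS](bigD1 i)//=.
  by rewrite lerDl sumr_ge0// => j _; exact: sqr_ge0.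
by rewrite sumr_ge0// => j _; exact: sqr_ge0.
Qed.

Lemma enorm_le_sum (x : d.-tuple (measurableTypeR R)) :
  enorm x <= \sum_(i < d) `|tnth x i : R|.
Proof.
have s0 : 0 <= \sum_(i < d) `|tnth x i : R| by exact: sumr_ge0.
rewrite /enorm -[leRHS]ger0_norm// -sqrtr_sqr ler_sqrt ?sqr_ge0//.
rewrite expr2 big_distrl/= ler_sum// => i _.
rewrite -real_normK ?num_real// expr2 ler_wpM2l//.
by rewrite (bigD1 i)//= lerDl sumr_ge0.
Qed.

Lemma measurable_enorm :
  measurable_fun setT (enorm : d.-tuple (measurableTypeR R) -> R).
Proof.
apply: (measurableT_comp (f := @Num.sqrt R)).
  by apply: continuous_measurable_fun; exact: sqrt_continuous.
apply: measurable_sum => i.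
by apply: measurable_funX; exact: measurable_tnth.
Qed.

Lemma measurable_cyl (r t : R) : measurable (cyl r t : set (stpoint R d)).
Proof.
have m1 : measurable_fun setT (fun y : stpoint R d => enorm y.1).
  exact: (measurableT_comp measurable_enorm measurable_fst).
have m2 : measurable_fun setT (fun y : stpoint R d => `|y.2 : R|).
  by apply: measurableT_comp => //; exact: measurable_snd.
rewrite (_ : cyl r t = [set y | enorm y.1 <= r] `&` [set y | `|y.2 : R| <= t]) //.
apply: measurableI; rewrite -[X in measurable X]setTI.
  exact: (measurable_fun_le measurableT m1 (measurable_cst r)).
exact: (measurable_fun_le measurableT m2 (measurable_cst t)).
Qed.

Lemma cyl_mono M M' : M <= M' -> cyl M M `<=` (cyl M' M' : set (stpoint R d)).
Proof. by move=> MM y [h1 h2]; split; apply: le_trans MM. Qed.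

Lemma bounded_cyl (r t : R) : bounded (cyl r t : set (stpoint R d)).
Proof.
by exists (Num.max r t) => y [h1 h2]; split; rewrite le_max ?h1 ?h2 ?orbT.
Qed.

Lemma bounded_sub (A B : set (stpoint R d)) : A `<=` B -> bounded B -> bounded A.
Proof. by move=> AB [M BM]; exists M; exact: subset_trans BM. Qed.

Lemma bigcup_cyl : \bigcup_k (cyl k%:R k%:R : set (stpoint R d)) = setT.
Proof.
apply/seteqP; split => // y _.
exists (Num.truncn (Num.max (enorm y.1) `|y.2 : R|)).+1 => //.
have := ltW (truncnS_gt (Num.max (enorm y.1) `|y.2 : R|)).
by rewrite ge_max => /andP[].
Qed.

(** The bound is obtained coordinate by coordinate: the Euclidean norm dominates
    each coordinate and is dominated by the sum of their absolute values. *)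
Lemma cyl_psub_bounded (M1 M2 r t : R) : exists M : R, forall y z : stpoint R d,
  cyl M1 M2 y -> cyl r t (psub y z) -> cyl M M z.
Proof.
exists (d%:R * (`|M1| + `|r|) + (`|M2| + `|t|)) => y z [y1 y2] [p1 p2].
have c1 i : `|tnth z.1 i : R| <= `|M1| + `|r|.
  have := ler_coord_enorm (psub y z).1 i; rewrite tnth_mktuple => /le_trans/(_ p1) h.
  have := ler_coord_enorm y.1 i => /le_trans/(_ y1) h'.
  rewrite -[X in `|X|](subKr (tnth y.1 i : R)).
  by rewrite (le_trans (ler_normB _ _))// lerD// (le_trans _ (ler_norm _)).
have c2 : `|z.2 : R| <= `|M2| + `|t|.
  rewrite -[X in `|X|](subKr (y.2 : R)).
  rewrite (le_trans (ler_normB _ _))// lerD// (le_trans _ (ler_norm _))//.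
split; last by rewrite (le_trans c2)// lerDr mulr_ge0// addr_ge0.
rewrite (le_trans (enorm_le_sum _))//.
rewrite (@le_trans _ _ (\sum_(i < d) (`|M1| + `|r|)))//; first exact: ler_sum.
by rewrite sumr_const card_ord mulr_natl lerDl addr_ge0.
Qed.

End bounded_sets.

(** * Configurations are purely atomic *)

Section atomicity.
Context {R : realType} {d : nat}.
Implicit Types (phi : config R d) (A : set (stpoint R d)).

Lemma config_gt0_ge1 phi A : measurable A -> bounded A -> (0 < phi A)%E ->
  (1 <= phi A)%E.
Proof.
by move=> mA bA; have [[|k] ->] := config_lf phi mA bA; rewrite ?ltxx// lee_fin ler1n.
Qed.

Lemma config_lty phi A : measurable A -> bounded A -> (phi A < +oo)%E.
Proof. by move=> mA bA; have [k ->] := config_lf phi mA bA; exact: ltry. Qed.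

(** A distribution function with values in the natural numbers increases only
    by jumps; the infimum of the levels at which it is positive is one. *)
Lemma charged_fiber phi A (c : stpoint R d -> R) (M : R) :
  measurable A -> bounded A -> measurable_fun setT c ->
  (forall y, A y -> `|c y| <= M) -> (0 < phi A)%E ->
  exists a, (0 < phi (A `&` [set y | c y = a]%R))%E.
Proof.
move=> mA bA mc cM A0.
have mle x : measurable (A `&` [set y | c y <= x]).
  apply: measurableI => //; rewrite -[X in measurable X]setTI.
  exact: (measurable_fun_le measurableT mc (measurable_cst x)).
have mlt x : measurable (A `&` [set y | c y < x]).
  apply: measurableI => //.
  rewrite (_ : [set y | c y < x] = ~` [set y | x <= c y]).
    apply: measurableC; rewrite -[X in measurable X]setTI.
    exact: (measurable_fun_le measurableT (measurable_cst x) mc).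
  by apply/seteqP; split => y /=; rewrite ltNge => /negP.
have ble x : bounded (A `&` [set y | c y <= x]).
  exact: bounded_sub bA.
pose E := [set x | (0 < phi (A `&` [set y | (c y <= x)%R]))%E].
have EM : E M.
  rewrite /E/= (_ : _ `&` _ = A)//; apply/seteqP; split => [y []//|y Ay].
  by split => //=; rewrite (le_trans (ler_norm _))// cM.
have lbE x : E x -> - M <= x.
  move=> Ex; rewrite leNgt; apply/negP => xM; move: Ex; rewrite /E/=.
  rewrite (_ : _ `&` _ = set0) ?measure0 ?ltxx//.
  rewrite -subset0 => y [/cM + /= cx]; rewrite ler_norml => /andP[+ _].
  by apply/negP; rewrite -ltNge (le_lt_trans cx).
have hE : has_inf E by split; [exists M|exists (- M)].
have Eup x y : E x -> x <= y -> E y.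
  move=> Ex xy; apply: lt_le_trans Ex _; apply: le_measure; rewrite ?inE//.
  by move=> z [Az /= cz]; split => //=; exact: le_trans xy.
exists (inf E).
pose B n := A `&` [set y | c y <= inf E + n.+1%:R^-1].
have BE : \bigcap_n B n = A `&` [set y | c y <= inf E].
  apply/seteqP; split => [y By|y [Ay /= cy] n _].
    split; first by have [] := By 0%N I.
    apply/ler_addgt0Pr => e e0 /=.
    have [_] := By (Num.truncn e^-1) I => /le_trans; apply.
    by rewrite lerD2l invf_ple ?posrE// ltW// truncnS_gt.
  by split => //=; rewrite (le_trans cy)// lerDl.
have B1 n : (1 <= phi (B n))%E.
  apply: (config_gt0_ge1 (mle _) (ble _)).
  have e0 : 0 < n.+1%:R^-1 :> R by rewrite invr_gt0.
  have [e Ee] := inf_adherent e0 hE.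
  by move=> /ltW; exact: (Eup e (inf E + n.+1%:R^-1) Ee).
have inf1 : (1 <= phi (A `&` [set y | (c y <= inf E)%R]))%E.
  have ndB : {homo B : n m / (n <= m)%N >-> (m <= n)%O}.
    move=> n m nm; apply/subsetPset => y [Ay /= cy]; split => //=.
    by rewrite (le_trans cy)// lerD2l lef_pV2 ?posrE ?ler_nat.
  have mB : measurable (\bigcap_n B n) by rewrite BE.
  have := nonincreasing_cvg_mu (mu := phi) (config_lty _ (mle _) (ble _))
    (fun=> mle _) mB ndB.
  by rewrite BE; apply: cvge_ge; exact: nearW.
have lt0 : phi (A `&` [set y | c y < inf E]) = 0%E.
  apply/negligibleP => //.
  rewrite (_ : _ `&` _ = \bigcup_n (A `&` [set y | c y <= inf E - n.+1%:R^-1])).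
    apply: negligible_bigcup => n; apply/negligibleP => //.
    apply/eqP; rewrite eq_le measure_ge0 andbT leNgt; apply/negP => h.
    have := ge_inf hE.2 h; rewrite lerBrDr gerDl leNgt.
    by rewrite invr_gt0 ltr0n.
  apply/seteqP; split => [y [Ay /= cy]|y [n _ [Ay /= cy]]].
    exists (Num.truncn (inf E - c y)^-1) => //; split => //=.
    rewrite lerBrDr -lerBrDl invf_ple ?posrE ?subr_gt0//.
    by rewrite ltW// truncnS_gt.
  by split => //=; rewrite (le_lt_trans cy)// ltrBlDr ltrDl.
have -> : A `&` [set y | c y = inf E] =
    (A `&` [set y | c y <= inf E]) `\` (A `&` [set y | c y < inf E]).
  apply/seteqP; split => [y [Ay /= ->]|y [[Ay /= cy] /not_andP[//|/= /negP]]].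
    by split; [split => //=|rewrite /= ltxx => -[]].
  by rewrite -leNgt => cy'; split => //=; apply/le_anti; rewrite cy cy'.
rewrite measureD//; last exact: config_lty.
have -> : (A `&` [set y | c y <= inf E]) `&` (A `&` [set y | c y < inf E]) =
    A `&` [set y | c y < inf E].
  by apply/seteqP; split => [y [_ //]|y [Ay /= cy]]; do 2!split => //=; exact: ltW.
rewrite [X in (_ - X)%E](_ : _ = 0%E); last exact: lt0.
by rewrite sube0 (lt_le_trans _ inf1).
Qed.

Lemma measurable_point (y : stpoint R d) : measurable [set y].
Proof. by rewrite -[X in measurable X]setCK; apply: measurableC; exact: measurable_pointC. Qed.

(** Spatial coordinates have the indices below d; every other index denotes the
    time coordinate, so that a point is determined by the first d + 1 values. *)
Definition coord (i : nat) (y : stpoint R d) : R :=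
  if insub i is Some j then tnth y.1 (j : 'I_d) else y.2.

Lemma measurable_coord i : measurable_fun setT (coord i).
Proof.
rewrite /coord; case: insub => [j|]; last exact: measurable_snd.
by apply: (measurableT_comp (measurable_tnth j)); exact: measurable_fst.
Qed.

Lemma coord_inj (y z : stpoint R d) :
  (forall i, (i < d.+1)%N -> coord i y = coord i z) -> y = z.
Proof.
case: y z => [y1 y2] [z1 z2] yz; congr pair; last first.
  by have := yz d (ltnSn d); rewrite /coord insubF//= ltnn.
apply: eq_from_tnth => i; have := yz i (leqW (ltn_ord i)).
by rewrite /coord (valK i).
Qed.

Lemma coord_bounded (M : R) (y : stpoint R d) i : cyl M M y -> `|coord i y| <= M.
Proof.
move=> [y1 y2]; rewrite /coord; case: insub => [j|//].
exact: le_trans (ler_coord_enorm _ _) y1.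
Qed.

(** Restricting successively to a charged fibre of each coordinate leaves a
    charged set with a single point. *)
Lemma charged_atom phi A : measurable A -> bounded A -> (0 < phi A)%E ->
  exists2 y, A y & atoms phi y.
Proof.
move=> mA bA A0; have [M AM] := bA.
have step k : exists B, [/\ measurable B, B `<=` A, (0 < phi B)%E &
    forall i, (i < k)%N -> forall y z, B y -> B z -> coord i y = coord i z].
  elim: k => [|k [B [mB BA B0 Bk]]]; first by exists A; split.
  have bB := bounded_sub BA bA.
  have [a Ba] := charged_fiber mB bB (measurable_coord k)
    (fun y By => coord_bounded k (AM y (BA y By))) B0.
  exists (B `&` [set y | coord k y = a]); split => //.
  - apply: measurableI => //; rewrite -[X in measurable X]setTI.
    exact: (measurable_coord k measurableT (measurable_set1 a)).
  - by move=> y [/BA].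
  - move=> i; rewrite ltnS leq_eqVlt => /predU1P[-> y z [_ /= ->] [_ /= ->]//|ik].
    by move=> y z [By _] [Bz _]; exact: Bk.
have [B [mB BA B0 Bd]] := step d.+1.
have [y By] : B !=set0.
  by apply/set0P/negP => /eqP B00; move: B0; rewrite B00 measure0 ltxx.
exists y; first exact: BA.
rewrite /atoms/= (_ : [set y] = B)//; apply/seteqP; split => [_ ->//|z Bz].
by apply: coord_inj => i id; exact: Bd.
Qed.

(** Every atom has mass at least 1, so the mass of a bounded set bounds the
    number of its atoms. *)
Lemma finite_atoms phi A : bounded A -> finite_set (atoms phi `&` A).
Proof.
move=> [M AM]; apply: (@sub_finite_set _ _ (atoms phi `&` cyl M M)).
  by move=> y [ay Ay]; split => //; exact: AM.
apply: contrapT => /infinite_set_fset nf.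
have [k phik] := config_lf phi (measurable_cyl M M) (bounded_cyl M M).
have [F FA Fk] := nf k.+1.
have phiF : (phi [set` F] <= k%:R%:E)%E.
  rewrite -phik; apply: le_measure; rewrite ?inE; last by move=> y /FA[].
    apply: countable_measurable; first exact: measurable_point.
    by apply: finite_set_countable; exact: finite_fset.
  exact: measurable_cyl.
have : ((size F)%:R%:E <= phi [set` F])%E.
  rewrite -[X in phi X]image_id -bigcup_imset1 measure_fin_bigcup//; last 2 first.
  - by move=> y z _ _ [w [/= -> ->]].
  - by move=> y _; exact: measurable_point.
  rewrite fsbig_finite//= set_fsetK -sum1_size natr_sum -sumEFin.
  rewrite big_seq [leRHS]big_seq; apply: lee_sum => y yF.
  apply: config_gt0_ge1; first exact: measurable_point.
    by exists M => _ ->; have [] := FA y yF.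
  by have [] := FA y yF.
by move=> /le_trans/(_ phiF); rewrite lee_fin ler_nat leqNgt Fk.
Qed.

End atomicity.

(** * Measurability of sums over the points of a configuration *)

Section atom_sums.
Context {R : realType} {d : nat}.
Implicit Types (phi : config R d) (A : set (stpoint R d)).

Lemma countable_atoms phi : countable (atoms phi).
Proof.
rewrite (_ : atoms phi = \bigcup_k (atoms phi `&` cyl k%:R k%:R)); last first.
  by rewrite -setI_bigcupr bigcup_cyl setIT.
apply: bigcup_countable => // k _; apply: finite_set_countable.
by apply: finite_atoms; exact: bounded_cyl.
Qed.

Lemma measurable_atoms phi : measurable (atoms phi).
Proof. by apply: countable_measurable (countable_atoms _); exact: measurable_point. Qed.

Lemma config_atomsC phi : phi (~` atoms phi) = 0%E.
Proof.
apply/negligibleP; first by apply: measurableC; exact: measurable_atoms.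
rewrite (_ : ~` _ = \bigcup_k (~` atoms phi `&` cyl k%:R k%:R)); last first.
  by rewrite -setI_bigcupr bigcup_cyl setIT.
apply: negligible_bigcup => k.
have m : measurable (~` atoms phi `&` cyl k%:R k%:R).
  apply: measurableI; last exact: measurable_cyl.
  by apply: measurableC; exact: measurable_atoms.
apply/negligibleP => //; apply/eqP; rewrite eq_le measure_ge0 andbT leNgt.
apply/negP => /charged_atom[] //; last by move=> y [].
by exists k%:R => y [].
Qed.

Lemma config_atom_fin phi y : phi [set y] \is a fin_num.
Proof.
rewrite ge0_fin_numE//; apply: config_lty; first exact: measurable_point.
have [k _ yk] : (\bigcup_k (cyl k%:R k%:R : set (stpoint R d))) y by rewrite bigcup_cyl.
by exists k%:R => _ ->.
Qed.

(** Dividing by the multiplicity turns the integral against the configuration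
    into a sum over its support, because a configuration charges nothing else. *)
Lemma esum_atoms phi (f : stpoint R d -> \bar R) :
  measurable_fun setT f -> (forall y, (0 <= f y)%E) ->
  measurable_fun setT (fun y => (fine (phi [set y]))^-1) ->
  \esum_(y in atoms phi) f y = (\int[phi]_y (f y * ((fine (phi [set y]))^-1)%:E))%E.
Proof.
move=> mf f0 mphi; pose g y := (f y * ((fine (phi [set y]))^-1)%:E)%E.
rewrite -[RHS]/(\int[phi]_y g y)%E.
have mg : measurable_fun setT g by apply: emeasurable_funM => //; exact/measurable_EFinP.
have g0 y : (0 <= g y)%E by rewrite mule_ge0// lee_fin invr_ge0 fine_ge0.
rewrite -[in RHS](setUv (atoms phi)) ge0_integral_setU//; last 4 first.
- exact: measurable_atoms.
- by apply: measurableC; exact: measurable_atoms.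
- by rewrite setUv.
- exact/disj_setPCl.
rewrite [X in (_ + X)%E]null_set_integral ?adde0//; last 3 first.
- by apply: measurableC; exact: measurable_atoms.
- exact: measurable_funTS.
- exact: config_atomsC.
have /countable_injP[idx injidx] := countable_atoms phi.
(* an enumeration of the atoms by sets with at most one element *)
pose F n := atoms phi `&` [set y | idx y = n].
have FU : \bigcup_n F n = atoms phi.
  by apply/seteqP; split => [y [n _ []]//|y ay]; exists (idx y).
have F1 n : F n = set0 \/ exists2 y, atoms phi y & F n = [set y].
  have [->|/set0P[y [ay yn]]] := eqVneq (F n) set0; first by left.
  right; exists y => //; apply/seteqP; split => [z [az zn]|_ ->]; last by split.
  by apply: injidx; rewrite ?inE// zn yn.
have tF : trivIset setT F by move=> i j _ _ [y [[_ <-] [_ <-]]].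
rewrite -[in LHS]FU nneseries_sum_bigcup//.
rewrite -[in RHS]FU ge0_integral_bigcup//; last 2 first.
- move=> n; have [->|[y _ ->]] := F1 n; first exact: measurable0.
  exact: measurable_point.
- exact: measurable_funTS.
apply: eq_eseriesr => n _.
have [->|[y ay ->]] := F1 n; first by rewrite esum_set0 integral_set0.
rewrite esum_set1// (eq_integral (cst (g y))); last by move=> z; rewrite inE => ->.
rewrite integral_cst; last exact: measurable_point.
rewrite /g -muleA -[X in (_ * (_ * X))%E](fineK (config_atom_fin phi y)) -EFinM.
rewrite mulVf ?mule1//; apply: lt0r_neq0.
by rewrite fine_gt0// ay -ge0_fin_numE// config_atom_fin.
Qed.

Section config_integral.
Context dX (X : measurableType dX) (pi : X -> config R d).

Lemma measurable_eval A : measurable A ->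
  measurable_fun setT (fun phi : config R d => phi A).
Proof.
move=> mA _ B mB; rewrite setTI; apply: sub_sigma_algebra.
by exists A => //; exists B.
Qed.

(** A measurable family of configurations is a kernel.  Its measures are only
    locally finite: [measurable_config_xsection] goes through bounded cylinders. *)
Definition config_kernel (mpi : measurable_fun setT pi) (x : X) :
  {measure set (stpoint R d) -> \bar R} := pi x.

Hypothesis mpi : measurable_fun setT pi.

Let measurable_config_kernel A : measurable A ->
  measurable_fun setT (config_kernel mpi ^~ A).
Proof. by move=> mA; apply: (measurableT_comp (measurable_eval mA)). Qed.

HB.instance Definition _ := isKernel.Build _ _ _ _ R (config_kernel mpi)
  measurable_config_kernel.

Lemma measurable_config_xsection (A : set (X * stpoint R d)) : measurable A ->
  measurable_fun setT (fun x => pi x (xsection A x)).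
Proof.
move=> mA.
have mk k := @measurable_prod_subset_xsection_kernel _ _ _ _ _
  (config_kernel mpi) _ (measurable_cyl k%:R k%:R).
apply: (@emeasurable_fun_cvg _ _ _ _ (fun k x => pi x (xsection A x `&` cyl k%:R k%:R))).
  move=> k; apply: (mk k _ A mA).2 => x.
  have [n xn] := config_lf (pi x) (measurable_cyl k%:R k%:R) (bounded_cyl k%:R k%:R).
  exists (n.+1%:R) => B mB; apply: (@le_lt_trans _ _ (pi x (cyl k%:R k%:R))).
    apply: le_measure; rewrite ?inE; last exact: subIsetr.
      by apply: measurableI => //; exact: measurable_cyl.
    exact: measurable_cyl.
  by rewrite xn lte_fin ltr_nat.
move=> x _; have -> : xsection A x = \bigcup_k (xsection A x `&` cyl k%:R k%:R).
  by rewrite -setI_bigcupr bigcup_cyl setIT.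
have mxk k : measurable (xsection A x `&` cyl k%:R k%:R).
  by apply: measurableI; [exact: measurable_xsection|exact: measurable_cyl].
rewrite -setI_bigcupr bigcup_cyl setIT.
have -> : pi x (xsection A x) = pi x (\bigcup_k (xsection A x `&` cyl k%:R k%:R)).
  by rewrite -setI_bigcupr bigcup_cyl setIT.
apply: nondecreasing_cvg_mu => //; first exact: bigcupT_measurable.
move=> n m nm; apply/subsetPset => y [Ay cy]; split => //.
by apply: cyl_mono cy; rewrite ler_nat.
Qed.

Import HBNNSimple.

Lemma measurable_config_integral (g : X * stpoint R d -> \bar R) :
  measurable_fun setT g -> (forall p, (0 <= g p)%E) ->
  measurable_fun setT (fun x => (\int[pi x]_y g (x, y))%E).
Proof.
move=> mg g0.
apply: (measurable_fun_xsection_integral g pi (nnsfun_approx measurableT mg)).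
- by move=> a b ab; exact/nd_nnsfun_approx.
- by move=> z; exact/cvg_nnsfun_approx.
- by move=> n r; exact: measurable_config_xsection.
Qed.

End config_integral.

Lemma measurable_diag : measurable [set p : stpoint R d * stpoint R d | p.1 = p.2].
Proof.
rewrite (_ : [set p | _] =
   \bigcap_(i in `I_d.+1) [set p : stpoint R d * stpoint R d | coord i p.1 = coord i p.2]).
  apply: fin_bigcap_measurable => // i _; rewrite -[X in measurable X]setTI.
  have : measurable_fun setT
      (fun p : stpoint R d * stpoint R d => coord i p.1 == coord i p.2).
    apply: measurable_fun_eqr.
      exact: (measurableT_comp (measurable_coord i) measurable_fst).
    exact: (measurableT_comp (measurable_coord i) measurable_snd).
  move=> /(_ measurableT [set true] I); congr measurable.
  by apply/seteqP; split => p /= [_ /eqP].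
apply/seteqP; split => [[y z] /= -> //|[y z] /= h]; exact: coord_inj.
Qed.

End atom_sums.

Section distinct_tuples.
Context {R : realType} {d : nat}.
Implicit Types (phi : config R d) (A : set (stpoint R d)).

(** Tuples of distinct elements of an arbitrary set: removing a point from a
    configuration removes it from the set of atoms. *)
Definition dtuples (n : nat) A : set (n.-tuple (stpoint R d)) :=
  [set v : n.-tuple (stpoint R d) | uniq v /\ tpow A v].

Arguments dtuples n A : clear implicits.

Lemma lift0P n (i : 'I_n.+1) : i = ord0 \/ exists j, i = lift ord0 j.
Proof. by case: (unliftP ord0 i) => [j ->|->]; [right; exists j|left]. Qed.

Lemma all_tnth_tcons dT (T : measurableType dT) n (A : set T) z (v : n.-tuple T) :
  (forall i, A (tnth (tcons (z, v)) i)) <-> A z /\ forall i, A (tnth v i).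
Proof.
split => [h|[Az Av] i].
  split => [|i]; first by have := h ord0; rewrite tnth0.
  by have := h (lift ord0 i); rewrite tnthS.
by case: (lift0P i) => [->|[j ->]]; rewrite ?tnth0 ?tnthS.
Qed.

Lemma tpow0 A (v : 0.-tuple (stpoint R d)) : tpow A v.
Proof. by case. Qed.

Lemma tpow_tcons n A (z : stpoint R d) (v : n.-tuple (stpoint R d)) :
  tpow A (tcons (z, v)) <-> A z /\ tpow A v.
Proof. exact: all_tnth_tcons. Qed.

Lemma dtuples0 A : dtuples 0 A = [set [tuple]].
Proof.
apply/seteqP; split => [v _|v -> ]; first exact: tuple0.
by split => //; exact: tpow0.
Qed.

Lemma esum_dtuplesS n A (a : n.+1.-tuple (stpoint R d) -> \bar R) :
  (forall v, (0 <= a v)%E) ->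
  \esum_(v in dtuples n.+1 A) a v =
  \esum_(z in A) \esum_(v in dtuples n (A `\ z)) a (tcons (z, v)).
Proof.
move=> a0; rewrite (esum_esum (a := fun z v => a (tcons (z, v))))//.
rewrite (reindex_esum (A `*`` (fun z => dtuples n (A `\ z))) _ (fun p => tcons p))//=.
split => /=.
- move=> [z v] [/= Az [uv Av]]; split => /=.
    rewrite uv andbT; apply/negP => /tnthP[i zi].
    by have [_ /=] := Av i; rewrite -zi; exact.
  by apply/tpow_tcons; split => // i; have [] := Av i.
- move=> [z v] [z' v'] _ _ /(congr1 val)/= [-> vv]; congr pair; exact: val_inj.
- move=> v [uv Av]; exists (thead v, [tuple of behead v]); last by rewrite [RHS]tuple_eta.
  rewrite [v]tuple_eta in uv Av; move: uv Av => /= /andP[zv uv] /tpow_tcons[Az Av].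
  split => //=; split => // i; split; first exact: Av.
  by move=> /= iz; move: zv; rewrite -iz => /negP; apply; exact: mem_tnth.
Qed.

End distinct_tuples.

Arguments dtuples {R d} n A.

Section measurable_tuple_sums.
Context {R : realType} {d : nat}.
Local Notation pt := (stpoint R d).

Lemma measurable_invr_ge0 dX (X : measurableType dX) (f : X -> R) :
  (forall x, 0 <= f x) -> measurable_fun setT f ->
  measurable_fun setT (fun x => (f x)^-1).
Proof.
move=> f0 mf; rewrite (_ : (fun _ => _) = (fun x => f x `^ (-1))).
  exact: (measurableT_comp (measurable_powR _) mf).
by apply/funext => x; rewrite powR_inv1.
Qed.

(** The multiplicity of a point is the mass of a section of the diagonal. *)
Lemma measurable_multiplicity dX (X : measurableType dX) (pi : X -> config R d) :
  measurable_fun setT pi ->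
  measurable_fun setT (fun p : X * pt => pi p.1 [set p.2]).
Proof.
move=> mpi.
have mE : measurable [set q : X * pt * pt | q.1.2 = q.2].
  rewrite -[X in measurable X]setTI.
  have mf : measurable_fun setT (fun q : X * pt * pt => (q.1.2, q.2)).
    apply: measurable_fun_pair; last exact: measurable_snd.
    exact: (measurableT_comp measurable_snd measurable_fst).
  exact: (mf measurableT _ measurable_diag).
have := measurable_config_xsection (measurableT_comp mpi measurable_fst) mE.
apply: eq_measurable_fun => p _ /=; congr (pi p.1 _).
by apply/seteqP; split => y; rewrite /xsection/= inE.
Qed.

Lemma measurable_esum_atoms dX (X : measurableType dX) (pi : X -> config R d)
    (g : X * pt -> \bar R) :
  measurable_fun setT pi -> measurable_fun setT g -> (forall p, (0 <= g p)%E) ->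
  measurable_fun setT (fun x => \esum_(y in atoms (pi x)) g (x, y)).
Proof.
move=> mpi mg g0.
have mV : measurable_fun setT (fun p : X * pt => (fine (pi p.1 [set p.2]))^-1).
  apply: measurable_invr_ge0; first by move=> p; rewrite fine_ge0.
  by apply: (measurableT_comp _ (measurable_multiplicity mpi)); exact: fine_measurable.
rewrite (_ : (fun _ => _) = (fun x => \int[pi x]_y
    (g (x, y) * ((fine (pi x [set y]))^-1)%:E))%E); last first.
  apply/funext => x; apply: esum_atoms => //.
    exact: (measurable_slice x mg).
  exact: (measurable_slice x mV).
apply: (measurable_config_integral mpi
  (g := fun p => (g p * ((fine (pi p.1 [set p.2]))^-1)%:E)%E)).
  by apply: emeasurable_funM => //; exact/measurable_EFinP.
by move=> p; rewrite mule_ge0// lee_fin invr_ge0 fine_ge0.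
Qed.

(** The first entry of a tuple is summed last: the sum over the other entries,
    required to differ from it, is jointly measurable by induction. *)
Lemma measurable_esum_tuples n dX (X : measurableType dX) (pi : X -> config R d)
    (h : X * n.-tuple pt -> \bar R) :
  measurable_fun setT pi -> measurable_fun setT h -> (forall p, (0 <= h p)%E) ->
  measurable_fun setT (fun x => \esum_(v in distinct_tuples n (pi x)) h (x, v)).
Proof.
elim: n => [|n ih] in dX X pi h *; move=> mpi mh h0.
  rewrite (_ : (fun _ => _) = (fun x => h (x, [tuple]))).
    apply: (measurableT_comp mh).
    by apply: measurable_fun_pair; [exact: measurable_id|exact: measurable_cst].
  by apply/funext => x; rewrite [distinct_tuples _ _]dtuples0 esum_set1.
pose E := [set q : X * pt * n.-tuple pt | q.1.2 \in (q.2 : seq _)].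
have mE : measurable E.
  rewrite (_ : E = \bigcup_(i in [set: 'I_n])
      [set q : X * pt * n.-tuple pt | q.1.2 = tnth q.2 i]); last first.
    apply/seteqP; split => [q /= /tnthP[i qi]|q [i _ /= qi]]; first by exists i.
    by rewrite /E/= qi; exact: mem_tnth.
  apply: fin_bigcup_measurable => // i _.
  have mf : measurable_fun setT (fun q : X * pt * n.-tuple pt => (q.1.2, tnth q.2 i)).
    apply: measurable_fun_pair.
      exact: (measurableT_comp measurable_snd measurable_fst).
    exact: (measurableT_comp (measurable_tnth i) measurable_snd).
  rewrite -[X in measurable X]setTI; exact: (mf measurableT _ measurable_diag).
pose h' (q : X * pt * n.-tuple pt) : \bar R :=
  (h (q.1.1, tcons (q.1.2, q.2)) * (\1_(~` E) q)%:E)%E.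
have mh' : measurable_fun setT h'.
  apply: emeasurable_funM.
    apply: (measurableT_comp mh); apply: measurable_fun_pair.
      exact: (measurableT_comp measurable_fst measurable_fst).
    apply: (measurableT_comp (@measurable_tcons _ _ _)).
    apply: measurable_fun_pair; last exact: measurable_snd.
    exact: (measurableT_comp measurable_snd measurable_fst).
  by apply/measurable_EFinP; apply: measurable_indic; exact: measurableC.
have h'0 q : (0 <= h' q)%E by rewrite mule_ge0.
rewrite (_ : (fun _ => _) = (fun x => \esum_(z in atoms (pi x))
    \esum_(v in distinct_tuples n (pi x)) h' (x, z, v))).
  apply: (measurable_esum_atoms (g := fun p =>
    \esum_(v in distinct_tuples n (pi p.1)) h' (p, v)) mpi).
    by apply: ih => //; exact: (measurableT_comp mpi measurable_fst).
  by move=> p; exact: esum_ge0.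
apply/funext => x; rewrite esum_dtuplesS//.
apply: eq_esum => z az; rewrite esum_mkcond [RHS]esum_mkcond.
apply: eq_esum => v _; rewrite /h' indicE/=.
have [/[!inE] -[uv Av]|nd] := boolP (v \in dtuples _ _).
  rewrite !mem_set ?mule1//.
    by move=> /tnthP[i zi]; have [_ /=] := Av i; rewrite -zi; exact.
  by split => // i; have [] := Av i.
case: ifPn => // /[!inE] -[uv Av]; rewrite memNset ?mule0// => zv.
move: nd; rewrite notin_setE; apply; split => // i; split; first exact: Av.
by move=> /= iz; apply: zv; rewrite /E/= -iz; exact: mem_tnth.
Qed.

End measurable_tuple_sums.

(** * Expansion of a product over the points of a configuration *)

Section void_polynomial.
Context {R : realType} {T : choiceType}.
Variable u : T -> R.

(** Its value at 1 is the product of the factors 1 - u z. *)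
Definition void_poly (s : seq T) : {poly R} := \prod_(z <- s) (1 - u z *: 'X).

Lemma deriv_void_poly s : uniq s ->
  (void_poly s)^`() = - \sum_(z <- s) u z *: void_poly (rem z s).
Proof.
rewrite /void_poly; elim: s => [_|y s ih /= /andP[ys us]].
  by rewrite !big_nil derivC oppr0.
rewrite big_cons derivM ih// big_cons eqxx derivB derivZ derivX derivC sub0r.
rewrite alg_polyC mulNr opprD; congr (_ + _).
  by rewrite -mul_polyC.
rewrite mulrN; congr (- _); rewrite mulr_sumr big_seq [RHS]big_seq.
apply: eq_bigr => z zs; rewrite ifN_eqC; last by apply: contraNneq ys => <-.
by rewrite big_cons scalerAr.
Qed.

Lemma coef0_void_poly s : (void_poly s)`_0 = 1.
Proof.
rewrite /void_poly; elim: s => [|y s ih]; first by rewrite big_nil coefC.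
by rewrite big_cons coef0M ih mulr1 coefB coefZ coefX mulr0 coefC subr0.
Qed.

Lemma horner1_void_poly s : (void_poly s).[1] = \prod_(z <- s) (1 - u z).
Proof.
rewrite /void_poly horner_prod; apply: eq_bigr => z _.
by rewrite !hornerE.
Qed.

End void_polynomial.

Section tuple_sums.
Context {R : realType} {d : nat}.
Local Notation pt := (stpoint R d).
Implicit Types (A : set pt) (u : pt -> R).

(** When u has finitely many nonzero values on A, this is n! times their n-th
    elementary symmetric function. *)
Definition tuple_sum n A u : \bar R :=
  \esum_(v in dtuples n A) (\prod_(i < n) u (tnth v i))%:E.

Lemma esum_support A (s : seq pt) (a : pt -> \bar R) : uniq s ->
  (forall z, (0 <= a z)%E) -> (forall z, z \in s -> A z) ->
  (forall z, A z -> z \notin s -> a z = 0%E) ->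
  \esum_(z in A) a z = (\sum_(z <- s) a z)%E.
Proof.
move=> us a0 sA As; rewrite fsbig_seq// -esum_fset//.
rewrite esum_mkcond [RHS]esum_mkcond; apply: eq_esum => z _.
have [zs|zs] := boolP (z \in s).
  by rewrite !mem_set//; exact: sA.
rewrite [in RHS]memNset; last exact/negP.
by case: ifPn => // /[!inE] Az; exact: As.
Qed.

(** Both sides satisfy the same recursion: singling out the first point of a
    tuple on the left, differentiating the product of the linear factors on
    the right. *)
Lemma tuple_sum_coef u : (forall z, 0 <= u z) ->
  forall n A (s : seq pt) c, 0 <= c -> uniq s ->
    (forall z, z \in s <-> A z /\ u z != 0) ->
  \esum_(v in dtuples n A) (c * \prod_(i < n) u (tnth v i))%:E =
  (c * ((-1) ^+ n * n`!%:R * (void_poly u s)`_n))%:E.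
Proof.
move=> u0; elim=> [|n ih] A s c c0 us sA.
  rewrite dtuples0 esum_set1; last by rewrite big_ord0 mulr1.
  by rewrite big_ord0 coef0_void_poly expr0 fact0 !mulr1.
have p0 k (v : k.-tuple pt) : 0 <= \prod_(i < k) u (tnth v i) by exact: prodr_ge0.
rewrite esum_dtuplesS; last by move=> v; rewrite lee_fin mulr_ge0.
rewrite (eq_esum (b := fun z : pt => ((c * u z) * ((-1) ^+ n * n`!%:R *
    (void_poly u (rem z s))`_n))%:E)); last first.
  move=> z Az; rewrite -(ih (A `\ z)) ?mulr_ge0 ?rem_uniq//.
    by apply: eq_esum => v _; rewrite big_ord_recl tnth0 mulrA;
      under eq_bigr do rewrite tnthS.
  move=> y; rewrite mem_rem_uniq// inE; split.
    by move=> /andP[/eqP yz /sA[Ay uy]].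
  by move=> [[Ay /eqP yz] uy]; rewrite yz/=; apply/sA.
rewrite (@esum_support _ s)//; last 3 first.
- move=> z.
  have [z0|uz] := eqVneq (u z) 0; first by rewrite z0 mulr0 mul0r.
  have [Az|nAz] := pselect (A z).
    rewrite -(ih (A `\ z)) ?mulr_ge0 ?rem_uniq//.
      by apply: esum_ge0 => v _; rewrite lee_fin !mulr_ge0.
    move=> y; rewrite mem_rem_uniq// inE; split.
      by move=> /andP[/eqP yz /sA[Ay uy]].
    by move=> [[Ay /eqP yz] uy]; rewrite yz/=; apply/sA.
  rewrite rem_id; last by apply/negP => /sA[].
  rewrite -(ih A) ?mulr_ge0//.
  by apply: esum_ge0 => v _; rewrite lee_fin !mulr_ge0.
- by move=> z /sA[].
- move=> z Az zs; have [z0|uz] := eqVneq (u z) 0; first by rewrite z0 mulr0 mul0r.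
  by move: zs => /negP; case; apply/sA.
rewrite sumEFin; congr (_%:E).
have := congr1 (fun p : {poly R} => p`_n) (deriv_void_poly u us).
rewrite /= coef_deriv coefN coef_sum => h.
have -> : \sum_(z <- s) c * u z * ((-1) ^+ n * n`!%:R * (void_poly u (rem z s))`_n)
    = c * ((-1) ^+ n * n`!%:R * - ((void_poly u s)`_n.+1 *+ n.+1)).
  rewrite h opprK !mulr_sumr; apply: eq_bigr => z _.
  rewrite coefZ -!mulrA; congr (_ * _); rewrite mulrCA; congr (_ * _).
  by rewrite mulrCA.
rewrite factS natrM exprS -mulr_natr; ring.
Qed.

End tuple_sums.

(** * The generating functional as an alternating series *)

Section generating_functional.
Context {R : realType} {d : nat}.
Local Notation pt := (stpoint R d).
Implicit Types (A : set pt) (phi : config R d).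
Variable u : pt -> R.
Hypotheses (mu : measurable_fun setT u) (u_ge0 : forall z, 0 <= u z)
  (u_bd : bounded [set z | u z != 0]).

Lemma tuple_sum_ge0 n A : (0 <= tuple_sum n A u)%E.
Proof. by apply: esum_ge0 => v _; rewrite lee_fin prodr_ge0. Qed.

(** Since u has bounded support, statements about its values at the atoms reduce
    to a finite list of points. *)
Lemma charged_support phi : exists2 s : seq pt, uniq s &
  forall z, z \in s <-> atoms phi z /\ u z != 0.
Proof.
have fin := finite_atoms phi u_bd.
exists (fset_set (atoms phi `&` [set z | u z != 0])) => [|z].
  exact: fset_uniq.
by rewrite in_fset_set//; split; rewrite inE.
Qed.

Lemma tuple_sum_charged phi (s : seq pt) n : uniq s ->
  (forall z, z \in s <-> atoms phi z /\ u z != 0) ->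
  tuple_sum n (atoms phi) u = ((-1) ^+ n * n`!%:R * (void_poly u s)`_n)%:E.
Proof.
move=> us sP; have := tuple_sum_coef u_ge0 n ler01 us sP; rewrite mul1r => <-.
by apply: eq_esum => v _; rewrite mul1r.
Qed.

Lemma tuple_sum_fin n phi : tuple_sum n (atoms phi) u \is a fin_num.
Proof. by have [s us sP] := charged_support phi; rewrite (tuple_sum_charged _ us sP). Qed.

Lemma measurable_tuple_sum n :
  measurable_fun setT (fun phi => tuple_sum n (atoms phi) u).
Proof.
apply: (measurable_esum_tuples (pi := id)
  (h := fun p => (\prod_(i < n) u (tnth p.2 i))%:E)) => //.
  apply/measurable_EFinP; apply: measurable_prod => i _.
  apply: (measurableT_comp mu).
  exact: (measurableT_comp (measurable_tnth i) measurable_snd).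
by move=> p; rewrite lee_fin prodr_ge0.
Qed.

Lemma point_prod_series phi : exists N0 : nat, forall N, (N0 <= N)%N ->
  \sum_(n < N) (-1) ^+ n / n`!%:R * fine (tuple_sum n (atoms phi) u) =
  point_prod (fun z => 1 - u z) phi.
Proof.
have [s us sP] := charged_support phi.
exists (size (void_poly u s)) => N sN.
rewrite /point_prod -(@fsbig_widen _ _ _ _ [set` s]).
- rewrite -fsbig_seq// -horner1_void_poly (horner_coef_wide _ sN).
  apply: eq_bigr => n _; rewrite (tuple_sum_charged _ us sP)/= expr1n mulr1.
  have n0 : n`!%:R != 0 :> R by rewrite pnatr_eq0 -lt0n fact_gt0.
  rewrite -!mulrA (mulrCA (n`!%:R^-1)) (mulrA (n`!%:R^-1)) mulVf// mul1r mulrA.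
  by rewrite -expr2 sqrr_sign mul1r.
- by move=> z /= /sP[].
- move=> z [az /= zs]; apply/eqP; rewrite subr_eq addrC -subr_eq subrr eq_sym.
  by apply/negPn/negP => uz; apply: zs; apply/sP.
Qed.

Variables (Q : {measure set (config R d) -> \bar R}) (m : nat -> R).
Hypotheses (Qm : forall n, (\int[Q]_phi tuple_sum n (atoms phi) u = (m n)%:E)%E)
  (m_lty : (\sum_(n <oo) (m n / n`!%:R)%:E < +oo)%E).

Let t n phi := fine (tuple_sum n (atoms phi) u).

Let tE n phi : (t n phi)%:E = tuple_sum n (atoms phi) u.
Proof. by rewrite fineK// tuple_sum_fin. Qed.

Let t_ge0 n phi : 0 <= t n phi.
Proof. by rewrite fine_ge0// tuple_sum_ge0. Qed.

Let mt n : measurable_fun setT (t n).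
Proof. by apply: (measurableT_comp _ (measurable_tuple_sum n)); exact: fine_measurable. Qed.

Let it n : Q.-integrable setT (EFin \o t n).
Proof.
apply/integrableP; split; first exact/measurable_EFinP.
under eq_integral do rewrite /= ger0_norm// tE.
by rewrite Qm ltry.
Qed.

(** The alternating expansion of the product is dominated by the same series
    without signs, whose integral is assumed finite. *)
Lemma generating_functional_series :
  series (fun n => (-1) ^+ n * (m n / n`!%:R)) @ \oo -->
  generating_functional Q (fun z => 1 - u z).
Proof.
pose f N phi := \sum_(n < N) ((-1) ^+ n / n`!%:R * t n phi)%:E.
pose g phi := (\sum_(n <oo) (t n phi / n`!%:R)%:E)%E.
have tfact n phi : (0 <= (t n phi / n`!%:R)%:E)%E by rewrite lee_fin divr_ge0.
have mf N : measurable_fun setT (f N).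
  apply: emeasurable_sum => n; apply/measurable_EFinP.
  by apply: measurable_funM.
have f_cvg phi : f ^~ phi @ \oo --> (point_prod (fun z => 1 - u z) phi)%:E.
  have [N0 N0P] := point_prod_series phi.
  apply: cvg_near_cst; exists N0 => // N /= N0N.
  by rewrite /f sumEFin; congr EFin; exact: N0P.
have mp : measurable_fun setT (fun phi => (point_prod (fun z => 1 - u z) phi)%:E).
  by apply: (@emeasurable_fun_cvg _ _ _ _ f) => // phi _; exact: f_cvg.
have mg1 n : measurable_fun setT (fun phi => (t n phi / n`!%:R)%:E).
  by apply/measurable_EFinP; apply: measurable_funM.
have mg : measurable_fun setT g.
  by apply: ge0_emeasurable_sum => // n _; exact: mg1.
have g0 phi : (0 <= g phi)%E by apply: nneseries_ge0.
have ig : Q.-integrable setT g.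
  apply/integrableP; split => //.
  under eq_integral do rewrite gee0_abs//.
  rewrite integral_nneseries//.
  rewrite (eq_eseriesr (g := fun n => (m n / n`!%:R)%:E))// => n _.
  under eq_integral do rewrite mulrC EFinM.
  rewrite ge0_integralZl//; last 2 first.
  - exact/measurable_EFinP.
  - by move=> phi _; rewrite lee_fin.
  under eq_integral do rewrite tE.
  by rewrite Qm -EFinM mulrC.
have fg phi N : (`|f N phi| <= g phi)%E.
  apply: (@le_trans _ _ (\sum_(0 <= n < N) (t n phi / n`!%:R)%:E)%E).
    rewrite big_mkord; apply: le_trans (lee_abs_sum _ _ _) _; apply: lee_sum => n _.
    rewrite /= lee_fin normrM normrM normrX normrN1 expr1n mul1r.
    by rewrite normfV !ger0_norm// mulrC.
  by apply: nneseries_lim_ge => n _ _; exact: tfact.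
have [ip _] := dominated_convergence measurableT mf mp (aeW _ (fun phi _ => f_cvg phi))
  ig (aeW _ (fun phi N _ => fg phi N)).
rewrite -[X in _ --> X -> _]fineK; last exact: integrable_fin_num.
move=> /fine_cvgP[_ h]; suff -> : series (fun n => (-1) ^+ n * (m n / n`!%:R)) =
    fine \o (fun N => \int[Q]_phi f N phi)%E by exact: h.
apply/funext => N /=; rewrite /series/= integral_sum//; last first.
  move=> n; under eq_fun do rewrite EFinM; apply: integrableZl => //; exact: it.
rewrite big_mkord -[LHS]/(fine (\sum_(n < N) ((-1) ^+ n * (m n / n`!%:R)))%:E).
rewrite -sumEFin; congr fine; apply: eq_bigr => n _.
under eq_integral do rewrite EFinM.
rewrite integralZl//=; last exact: it.
under eq_integral do rewrite /= tE.
by rewrite Qm -EFinM -mulrA (mulrC _ (m n)).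
Qed.

End generating_functional.

(** * Integration over power spaces *)

Section power_measure_theory.
Context dd (T : measurableType dd) (R : realType).
Variable mu : {sigma_finite_measure set T -> \bar R}.
Local Notation pm := (power_measure mu).
Local Open Scope ereal_scope.

Lemma measurable_tcons_slice n (x : T) :
  measurable_fun setT (fun v : n.-tuple T => tcons (x, v)).
Proof.
apply: (measurableT_comp (@measurable_tcons _ _ _)).
by apply: measurable_fun_pair; [exact: measurable_cst|exact: measurable_id].
Qed.

Lemma integral_power0 (g : 0.-tuple T -> \bar R) : measurable_fun setT g ->
  \int[pm 0]_v g v = g [tuple].
Proof. by move=> mg; rewrite /= integral_dirac// diracT mul1e. Qed.

Lemma integral_powerS n (g : n.+1.-tuple T -> \bar R) : measurable_fun setT g ->
  (forall v, 0 <= g v) ->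
  \int[pm n.+1]_v g v = \int[mu]_x \int[pm n]_v g (tcons (x, v)).
Proof.
move=> mg g0; have mt := @measurable_tcons _ T n.
rewrite [LHS](ge0_integral_pushforward (phi := @tcons _ T n) mt)//.
rewrite preimage_setT /= fubini_tonelli1//.
by apply: (measurableT_comp mg).
Qed.

Lemma measurable_slice_integral n (g : n.+1.-tuple T -> \bar R) :
  measurable_fun setT g -> (forall v, 0 <= g v) ->
  measurable_fun setT (fun x => \int[pm n]_v g (tcons (x, v))).
Proof.
move=> mg g0.
apply: (@measurable_fun_fubini_tonelli_F _ _ _ _ _ (pm n) (fun p => g (tcons p))) => //.
by apply: (measurableT_comp mg); exact: measurable_tcons.
Qed.

Section sequence_functions.

(** Functions of finite point patterns of unspecified size; this avoids casts
    between tuples of provably equal lengths. *)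
Definition mseq d' (V : measurableType d') (g : seq T -> V) :=
  forall k, measurable_fun setT (fun v : k.-tuple T => g v).

Lemma mseq_cons d' (V : measurableType d') (g : seq T -> V) x :
  mseq g -> mseq (fun s => g (x :: s)).
Proof. by move=> mg k; exact: (measurableT_comp (mg k.+1) (measurable_tcons_slice x)). Qed.

Lemma mseq_mask d' (V : measurableType d') (g : seq T -> V) n (m : bitseq) :
  mseq g -> size m = n ->
  measurable_fun setT (fun v : n.-tuple T => g (mask m v)).
Proof.
move=> mg mn.
have sz (v : n.-tuple T) : size (mask m v) == count id m.
  by rewrite size_mask// size_tuple.
apply: (measurableT_comp (mg (count id m)) (g := fun v => Tuple (sz v))).
apply/measurable_fun_tnthP => i.
have jn : (nth 0%N (mask m (iota 0 n)) i < n)%N.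
  have : nth 0%N (mask m (iota 0 n)) i \in iota 0 n.
    apply: (mem_mask (m := m)); apply: mem_nth.
    by rewrite size_mask ?size_iota.
  by rewrite mem_iota.
rewrite (_ : _ \o _ = (fun v : n.-tuple T => tnth v (Ordinal jn))).
  exact: measurable_tnth.
apply/funext => v /=; rewrite !(tnth_nth point)/=.
have {1}-> : tval v = map (nth point v) (iota 0 n).
  by rewrite -[in iota 0 n](size_tuple v) map_nth_iota0// take_size.
by rewrite -map_mask (nth_map 0%N)// size_mask// size_iota.
Qed.

(** Splitting the coordinates of a point of a power space along a mask splits
    the power measure into a product. *)
Lemma integral_mask n (m : bitseq) (g h : seq T -> \bar R) :
  mseq g -> mseq h -> (forall s, 0 <= g s) -> (forall s, 0 <= h s) -> size m = n ->
  \int[pm n]_v (g (mask m v) * h (mask (map negb m) v)) =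
  (\int[pm (count id m)]_v g v) * (\int[pm (count negb m)]_v h v).
Proof.
elim: n m g h => [|n ih] [|b m]// g h mg mh g0 h0 => [_|[mn]].
  by rewrite !integral_power0//=; apply: emeasurable_funM; apply: mseq_mask.
rewrite integral_powerS; last by move=> v; rewrite mule_ge0.
  case: b => /=.
    transitivity (\int[mu]_x ((\int[pm (count id m)]_v g (x :: v)) *
        (\int[pm (count negb m)]_v h v))).
      by apply: eq_integral => x _; rewrite -(ih m (fun s => g (x :: s)) h)//; exact: mseq_cons.
    rewrite ge0_integralZr//.
    - by rewrite (integral_powerS (g := fun v => g v)).
    - by apply: (measurable_slice_integral (g := fun v => g v)).
    - by move=> x _; exact: integral_ge0.
    - exact: integral_ge0.
  transitivity (\int[mu]_x ((\int[pm (count id m)]_v g v) *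
      (\int[pm (count negb m)]_v h (x :: v)))).
    by apply: eq_integral => x _; rewrite -(ih m g (fun s => h (x :: s)))//; exact: mseq_cons.
  rewrite ge0_integralZl//.
  - by rewrite (integral_powerS (g := fun v => h v)).
  - by apply: (measurable_slice_integral (g := fun v => h v)).
  - by move=> x _; exact: integral_ge0.
  - exact: integral_ge0.
apply: emeasurable_funM; apply: mseq_mask => //; rewrite /= ?size_map ?mn//.
Qed.

(** The mass of the preimage of a null set factors as 0 times the possibly
    infinite mass of the space of the other coordinates, which is 0. *)
Lemma ae_mask n (m : bitseq) (P : seq T -> Prop) : size m = n ->
  {ae pm (count id m), forall v : (count id m).-tuple T, P v} ->
  {ae pm n, forall v : n.-tuple T, P (mask m v)}.
Proof.
move=> mn [N [mN N0 PN]].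
pose g (s : seq T) : \bar R := (\1_[set s | exists2 v, N v & tval v = s] s)%:E.
have gE v : g (tval v) = (\1_N v)%:E.
  rewrite /g indicE/= indicE; congr ((nat_of_bool _)%:R%:E); apply/idP/idP; rewrite !inE/=.
    by move=> [w Nw /val_inj <-].
  by move=> Nv; exists v.
have mg : mseq g.
  move=> k; have [<-|kn] := eqVneq (count id m) k.
    rewrite (_ : (fun _ => _) = (fun v => (\1_N v)%:E)); last exact/funext/gE.
    by apply/measurable_EFinP; exact: measurable_indic.
  rewrite (_ : (fun _ => _) = cst 0); first exact: measurable_cst.
  apply/funext => v; rewrite /g indicE memNset// => -[w _ /(congr1 size)].
  by rewrite !size_tuple => wk; rewrite wk eqxx in kn.
have g0 s : 0 <= g s by rewrite lee_fin.
have m1 : mseq (fun _ : seq T => 1 : \bar R) by move=> k; exact: measurable_cst.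
pose M := [set v : n.-tuple T | g (mask m v) != 0].
have mM : measurable M.
  rewrite -[X in measurable X]setTI; apply: measurable_neqe => //.
  exact: mseq_mask.
exists M; split => //.
  have := integral_mask mg m1 g0 (fun=> lee01) mn.
  under [X in _ = X * _]eq_integral do rewrite gE.
  rewrite integral_indic// setIT [X in X * _]N0 mul0e => h.
  apply/eqP; rewrite eq_le measure_ge0 andbT -h.
  have <- : \int[pm n]_v (\1_M v)%:E = pm n M by rewrite integral_indic// setIT.
  apply: ge0_le_integral => //.
  - by apply/measurable_EFinP; exact: measurable_indic.
  - by apply: emeasurable_funM => //; exact: mseq_mask.
  - move=> v _; rewrite mule1 indicE.
    have [|_] := boolP (v \in M); last exact: g0.
    by rewrite inE /M/= /g indicE; case: (_ \in _) => //=; rewrite eqxx.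
move=> v nP; rewrite /M/=.
have sz : size (mask m v) == count id m by rewrite size_mask// size_tuple.
have Nv : N (Tuple sz) by apply: PN.
by rewrite -[mask m v]/(tval (Tuple sz)) gE indicE mem_set//= eqe oner_eq0.
Qed.

End sequence_functions.
End power_measure_theory.

Section mask_product_signed.
Context dd (T : measurableType dd) (R : realType).
Variable mu : {sigma_finite_measure set T -> \bar R}.
Local Notation pm := (power_measure mu).
Implicit Types a b : seq T -> R.

Lemma mseq_EFin a : mseq a -> mseq (EFin \o a).
Proof. by move=> ma k; apply/measurable_EFinP; exact: ma. Qed.

Lemma mseq_mul a b : mseq a -> mseq b -> mseq (fun s => a s * b s).
Proof. by move=> ma mb k; exact: (measurable_funM (ma k) (mb k)). Qed.

Lemma mseq_comp a (f : R -> R) : measurable_fun setT f -> mseq a -> mseq (f \o a).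
Proof. by move=> mf ma k; exact: (measurableT_comp mf (ma k)). Qed.

Lemma measurable_mask_product n (m : bitseq) a b : mseq a -> mseq b -> size m = n ->
  measurable_fun setT (fun v : n.-tuple T => a (mask m v) * b (mask (map negb m) v)).
Proof.
move=> ma mb mn; apply: measurable_funM; first exact: (mseq_mask ma mn).
by apply: (mseq_mask mb); rewrite size_map.
Qed.

Lemma integrable_mask n (m : bitseq) a b : mseq a -> mseq b -> size m = n ->
  (pm (count id m)).-integrable setT (fun v => (a v)%:E) ->
  (pm (count negb m)).-integrable setT (fun v => (b v)%:E) ->
  (pm n).-integrable setT (fun v => (a (mask m v) * b (mask (map negb m) v))%:E).
Proof.
move=> ma mb mn /integrableP[_ ia] /integrableP[_ ib].
apply/integrableP; split; first by apply/measurable_EFinP; exact: measurable_mask_product.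
have mnorm (c : seq T -> R) : mseq c -> mseq (fun s => `|(c s)%:E|%E).
  move=> mc k; apply: measurableT_comp => //; exact: mseq_EFin.
under eq_integral do rewrite EFinM abseM.
rewrite (integral_mask mu (mnorm a ma) (mnorm b mb))//.
rewrite lte_mul_pinfty//; first exact: integral_ge0.
rewrite ge0_fin_numE//; exact: integral_ge0.
Qed.

Let pos a s := Num.max (a s) 0.

Let pos_sub a : a = fun s => pos a s - pos (fun s => - a s) s.
Proof.
apply/funext => s; rewrite /pos; have [h|h] := leP (a s) 0.
  by rewrite max_l ?oppr_ge0// sub0r opprK.
by rewrite max_r ?oppr_le0 ?(ltW h)// subr0.
Qed.

Let mseq_pos a : mseq a -> mseq (pos a).
Proof. by move=> ma k; exact: (measurable_funrpos (ma k)). Qed.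

Let mseq_opp a : mseq a -> mseq (fun s => - a s).
Proof. by move=> ma; apply: mseq_comp ma; exact: oppr_measurable. Qed.

Let pos_ge0 a s : 0 <= pos a s.
Proof. by rewrite le_max lexx orbT. Qed.

Let integrable_pos k a : mseq a ->
  (pm k).-integrable setT (fun v => (a v)%:E) ->
  (pm k).-integrable setT (fun v => (pos a v)%:E).
Proof.
move=> ma; apply: le_integrable => //.
  by apply/measurable_EFinP; exact: (mseq_pos ma (k := k)).
move=> v _ /=; rewrite lee_fin ger0_norm// /pos ge_max normr_ge0 andbT.
exact: ler_norm.
Qed.

Let integrable_opp k a : (pm k).-integrable setT (fun v => (a v)%:E) ->
  (pm k).-integrable setT (fun v => (- a v)%:E).
Proof. by move=> ia; have := integrableN ia; apply: eq_integrable. Qed.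

Let Rintegral_mask_ge0 n (m : bitseq) a b : mseq a -> mseq b -> size m = n ->
  (forall s, 0 <= a s) -> (forall s, 0 <= b s) ->
  (pm (count id m)).-integrable setT (fun v => (a v)%:E) ->
  (pm (count negb m)).-integrable setT (fun v => (b v)%:E) ->
  \int[pm n]_v (a (mask m v) * b (mask (map negb m) v)) =
  (\int[pm (count id m)]_v a v) * (\int[pm (count negb m)]_v b v).
Proof.
move=> ma mb mn a0 b0 ia ib; rewrite /Rintegral.
under eq_integral do rewrite EFinM.
rewrite (integral_mask mu (mseq_EFin ma) (mseq_EFin mb))//.
by rewrite fineM//; exact: integrable_fin_num.
Qed.

(** Splitting one factor after the other into positive and negative parts
    reduces to the case of nonnegative functions. *)
Lemma Rintegral_mask n (m : bitseq) a b : mseq a -> mseq b -> size m = n ->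
  (pm (count id m)).-integrable setT (fun v => (a v)%:E) ->
  (pm (count negb m)).-integrable setT (fun v => (b v)%:E) ->
  \int[pm n]_v (a (mask m v) * b (mask (map negb m) v)) =
  (\int[pm (count id m)]_v a v) * (\int[pm (count negb m)]_v b v).
Proof.
move=> ma mb mn ia ib.
have semi (c e : seq T -> R) : mseq c -> mseq e -> (forall s, 0 <= e s) ->
  (pm (count id m)).-integrable setT (fun v => (c v)%:E) ->
  (pm (count negb m)).-integrable setT (fun v => (e v)%:E) ->
  \int[pm n]_v (c (mask m v) * e (mask (map negb m) v)) =
  (\int[pm (count id m)]_v c v) * (\int[pm (count negb m)]_v e v).
  move=> mc me e0 ic ie.
  have mc1 := mseq_pos mc; have mc2 := mseq_pos (mseq_opp mc).
  have ic1 := integrable_pos mc ic.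
  have ic2 := integrable_pos (mseq_opp mc) (integrable_opp ic).
  transitivity (\int[pm n]_v (pos c (mask m v) * e (mask (map negb m) v) -
      pos (fun s => - c s) (mask m v) * e (mask (map negb m) v))).
    by apply: eq_Rintegral => v _; rewrite -mulrBl [in LHS](pos_sub c).
  rewrite (RintegralB measurableT (integrable_mask mc1 me mn ic1 ie)
    (integrable_mask mc2 me mn ic2 ie)).
  rewrite !Rintegral_mask_ge0// -mulrBl -RintegralB//.
  by congr (_ * _); apply: eq_Rintegral => v _; rewrite [in RHS](pos_sub c).
have mb1 := mseq_pos mb; have mb2 := mseq_pos (mseq_opp mb).
have ib1 := integrable_pos mb ib.
have ib2 := integrable_pos (mseq_opp mb) (integrable_opp ib).
transitivity (\int[pm n]_v (a (mask m v) * pos b (mask (map negb m) v) -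
    a (mask m v) * pos (fun s => - b s) (mask (map negb m) v))).
  by apply: eq_Rintegral => v _; rewrite -mulrBr [in LHS](pos_sub b).
rewrite (RintegralB measurableT (integrable_mask ma mb1 mn ia ib1)
  (integrable_mask ma mb2 mn ia ib2)).
rewrite !semi// -mulrBr -RintegralB//.
by congr (_ * _); apply: eq_Rintegral => v _; rewrite [in RHS](pos_sub b).
Qed.

End mask_product_signed.

(** * Translation invariance of power measures *)

Section translation.

(** The displacement may differ from one coordinate to another, so that the
    same lemma moves a point of a Euclidean space and a tuple of such points. *)
Lemma integral_power_act dd (T : measurableType dd) (R : realType)
    (mu : {sigma_finite_measure set T -> \bar R}) (C : Type) (act : T -> C -> T) :
  (forall c, measurable_fun setT (act ^~ c)) ->
  (forall c (g : T -> \bar R), measurable_fun setT g -> (forall x, 0 <= g x)%E ->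
    (\int[mu]_x g (act x c) = \int[mu]_x g x)%E) ->
  forall n (c : n.-tuple C) (g : n.-tuple T -> \bar R),
    measurable_fun setT g -> (forall v, 0 <= g v)%E ->
    (\int[power_measure mu n]_v g [tuple act (tnth v i) (tnth c i) | i < n] =
     \int[power_measure mu n]_v g v)%E.
Proof.
move=> mact inv; elim=> [|n ih] c g mg g0.
  by apply: eq_integral => v _; congr g; apply: eq_from_tnth => -[].
have mA k (e : k.-tuple C) : measurable_fun setT
    (fun v : k.-tuple T => [tuple act (tnth v i) (tnth e i) | i < k]).
  apply/measurable_fun_tnthP => i; rewrite (_ : _ \o _ = (fun v => act (tnth v i) (tnth e i))).
    by apply: (measurableT_comp (mact _)); exact: measurable_tnth.
  by apply/funext => v; rewrite /= tnth_mktuple.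
rewrite [LHS]integral_powerS//; last exact: (measurableT_comp mg (mA _ c)).
rewrite [RHS](integral_powerS mu mg g0).
have E x (v : n.-tuple T) : [tuple act (tnth (tcons (x, v)) i) (tnth c i) | i < n.+1] =
    tcons (act x (thead c), [tuple act (tnth v i) (tnth [tuple of behead c] i) | i < n]).
  apply: eq_from_tnth => i; rewrite tnth_mktuple.
  have [->|[j ->]] := lift0P i; first by rewrite !tnth0.
  by rewrite !tnthS tnth_mktuple [in LHS](tuple_eta c) tnthS.
transitivity (\int[mu]_x (fun y => \int[power_measure mu n]_v g (tcons (y, v)))
    (act x (thead c)))%E.
  apply: eq_integral => x _; under eq_integral do rewrite E.
  apply: (ih [tuple of behead c] (fun w => g (tcons (act x (thead c), w)))) => //.
  exact: (measurableT_comp mg (measurable_tcons_slice _)).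
apply: inv; first exact: measurable_slice_integral.
by move=> y; exact: integral_ge0.
Qed.

Lemma integral_lebesgue_shift (R : realType) (c : R) (g : measurableTypeR R -> \bar R) :
  measurable_fun setT g -> (forall x, 0 <= g x)%E ->
  (\int[@lebesgue_measure R]_x g ((x : R) + c)%R = \int[@lebesgue_measure R]_x g x)%E.
Proof.
move=> mg g0.
have ms : measurable_fun setT (fun x : measurableTypeR R => (x : R) + c : measurableTypeR R).
  by apply: measurable_funD.
have := @ge0_integral_pushforward _ _ _ _ _ _ ms (@lebesgue_measure R) setT g
  measurableT mg (fun x _ => g0 x).
rewrite preimage_setT => <-.
apply: eq_measure_integral => A mA _; apply/esym.
apply: (lebesgue_measure_unique (mu := pushforward _ _)) => //.
move=> _ [[a b] _ <-]; 
have E : (fun x : R => x + c) @^-1` `]a, b]%classic = `]a - c, b - c]%classic.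
  by apply/seteqP; split => x /=; rewrite !in_itv/= ltrBlDr lerBrDr.
rewrite -[RHS]/(lebesgue_measure ((fun x : R => x + c) @^-1` `]a, b]%classic)) E.
rewrite !lebesgue_measure_itv/= !lte_fin ltrD2r; case: ifP => // _.
by rewrite -!EFinD; congr EFin; ring.
Qed.

Section space_time_translation.
Context {R : realType} {d : nat}.
Local Notation pt := (stpoint R d).

Lemma measurable_padd (c : pt) : measurable_fun setT (padd ^~ c).
Proof.
apply: measurable_fun_pair.
  apply/measurable_fun_tnthP => i.
  rewrite (_ : _ \o _ = (fun y : pt => (tnth y.1 i : R) + tnth c.1 i)); last first.
    by apply/funext => y; rewrite /= tnth_mktuple.
  apply: measurable_funD => //.
  exact: (measurableT_comp (measurable_tnth i) measurable_fst).
by apply: measurable_funD => //; exact: measurable_snd.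
Qed.

Lemma integral_leb_shift (c : pt) (g : pt -> \bar R) :
  measurable_fun setT g -> (forall x, 0 <= g x)%E ->
  (\int[leb]_y g (padd y c) = \int[leb]_y g y)%E.
Proof.
move=> mg g0.
have mgc := measurableT_comp mg (measurable_padd c).
have msl x := measurable_slice x mg.
rewrite [LHS]fubini_tonelli1//.
rewrite [RHS](fubini_tonelli1 _ mg g0).
pose h x := (\int[@lebesgue_measure R]_y g (x, y))%E.
transitivity (\int[power_measure (@lebesgue_measure R) d]_x
    h [tuple ((tnth x i : R) + tnth c.1 i)%R | i < d])%E.
  apply: eq_integral => x _; rewrite /fubini_F/h/padd/=.
  exact: (integral_lebesgue_shift c.2 (g := fun y => g (_, y))).
apply: (integral_power_act (act := fun (a : measurableTypeR R) (e : R) => (a : R) + e)).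
- by move=> e; apply: measurable_funD.
- by move=> e f mf f0; exact: integral_lebesgue_shift.
- exact: (measurable_fun_fubini_tonelli_F _ mg g0).
- by move=> x; exact: integral_ge0.
Qed.

Lemma integral_tshift n (c : pt) (g : n.-tuple pt -> \bar R) :
  measurable_fun setT g -> (forall v, 0 <= g v)%E ->
  (\int[power_measure leb n]_v g (tshift v c) = \int[power_measure leb n]_v g v)%E.
Proof.
move=> mg g0.
rewrite -(integral_power_act (act := padd) _ _ [tuple c | _ < n] mg g0).
- apply: eq_integral => v _; congr g; apply: eq_from_tnth => i.
  by rewrite !tnth_mktuple.
- exact: measurable_padd.
- by move=> e f mf f0; exact: integral_leb_shift.
Qed.

End space_time_translation.

End translation.

(** * Sums over set partitions *)

Section partition_sums.
Context {T : Type} {R : realType}.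

(** The sum over all set partitions of the entries of s of the product of f over
    the blocks, computed by choosing with a mask the companions of the first
    entry in its block; k bounds the size of s to make the recursion structural. *)
Fixpoint psum_rec (k : nat) (f : seq T -> R) (s : seq T) : R :=
  match k, s with
  | k'.+1, x :: s' => \sum_(m : (size s').-tuple bool)
      f (x :: mask m s') * psum_rec k' f (mask (map negb m) s')
  | _, _ => 1
  end.

Definition psum f s := psum_rec (size s) f s.

Lemma size_mask_le (A : Type) (m : bitseq) (s : seq A) : (size (mask m s) <= size s)%N.
Proof. by elim: s m => [|x s ih] [|[|] m] //=; rewrite ?ltnS ?leqW. Qed.

Lemma psum_recE k f s : (size s <= k)%N -> psum_rec k f s = psum f s.
Proof.
rewrite /psum; have [n] := ubnP (size s); elim: n s k => // n ih [|x s] [|k]//=.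
rewrite !ltnS => sn sk; apply: eq_bigr => m _; congr (_ * _).
have ms := size_mask_le (map negb m) s.
have h := leq_ltn_trans ms sn.
by rewrite (ih _ _ h (leq_trans ms sk)) (ih _ _ h ms).
Qed.

Lemma psum_nil f : psum f [::] = 1.
Proof. by []. Qed.

Lemma psum_cons f x (s : seq T) n : size s = n ->
  psum f (x :: s) =
  \sum_(m : n.-tuple bool) f (x :: mask m s) * psum f (mask (map negb m) s).
Proof.
move=> <-; rewrite /psum/=; apply: eq_bigr => m _.
by rewrite psum_recE// size_mask_le.
Qed.

(** Every block is obtained from s by masking, so a property stable under masks
    holds for all of them. *)
Lemma eq_psum f g (P : seq T -> Prop) (s : seq T) :
  (forall s' m, P s' -> P (mask m s')) -> P s ->
  (forall x s', P (x :: s') -> f (x :: s') = g (x :: s')) ->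
  psum f s = psum g s.
Proof.
move=> Pm Ps fg; have [n] := ubnP (size s); elim: n s Ps => // n ih [|x s]// Ps sn.
rewrite !(psum_cons _ _ (erefl (size s))); apply: eq_bigr => m _; congr (_ * _).
  by apply: fg; exact: (Pm _ (true :: m) Ps).
apply: ih; first exact: (Pm _ (false :: map negb m) Ps).
by rewrite (leq_ltn_trans (size_mask_le _ _)).
Qed.

Lemma psum_map f (h : T -> T) (s : seq T) :
  (forall x s', f (map h (x :: s')) = f (x :: s')) ->
  psum f (map h s) = psum f s.
Proof.
move=> fh; have [n] := ubnP (size s); elim: n s => // n ih [|x s]// sn.
rewrite /= !(@psum_cons _ _ _ (size s)) ?size_map//; apply: eq_bigr => m _.
rewrite -!map_mask -/(map h (x :: _)) fh; congr (_ * _).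
by rewrite ih// (leq_ltn_trans (size_mask_le _ _)).
Qed.

End partition_sums.

Section set_partition_sums.
Context {I : finType} {R : realType}.
Variable F : {set I} -> R.

Definition setpart_sum (A : {set I}) : R :=
  \sum_(P : {set {set I}} | finset.partition P A) \prod_(D in P) F D.

Lemma setpart_sum0 : setpart_sum finset.set0 = 1.
Proof.
rewrite /setpart_sum (big_pred1 (finset.set0 : {set {set I}})).
  by rewrite big_set0.
by move=> P; rewrite finset.partition_set0.
Qed.

(** Partitions are classified by the block of a given element. *)
Lemma setpart_sum_block (A : {set I}) (x : I) : x \in A ->
  setpart_sum A =
  \sum_(D : {set I} | (x \in D) && (D \subset A)) F D * setpart_sum (A :\: D)%SET.
Proof.
move=> xA; rewrite /setpart_sum.
rewrite (partition_big (fun P => finset.pblock P x)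
  (fun D : {set I} => (x \in D) && (D \subset A))); last first.
  move=> P PA; have xc : x \in finset.cover P by rewrite (finset.cover_partition PA).
  by rewrite finset.mem_pblock xc (finset.partitionS PA)// finset.pblock_mem.
apply: eq_bigr => D /andP[xD DA]; rewrite big_distrr/=.
have D0 : D != finset.set0 by apply/set0Pn; exists x.
rewrite (reindex_onto (fun Q : {set {set I}} => D |: Q)%SET (fun P => P :\ D)%SET); last first.
  move=> P /andP[PA /eqP PD]; rewrite finset.setD1K// -PD finset.pblock_mem//.
  by rewrite (finset.cover_partition PA).
have DQ (Q : {set {set I}}) : finset.partition Q (A :\: D)%SET -> D \notin Q.
  move=> QA; apply: contra D0 => DQ; rewrite -finset.subset0 -(finset.setDv D).
  apply/fintype.subsetP => y yD; have /fintype.subsetP/(_ y yD) := finset.partitionS QA DQ.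
  by rewrite finset.in_setD => /andP[]; rewrite yD.
apply: eq_big => [Q|Q /andP[/andP[PA _] /eqP QD]].
  apply/idP/idP => [/andP[/andP[PA _] /eqP QD]|QA].
    by have := finset.partitionD1 PA (finset.setU11 D Q); rewrite QD.
  have PA : finset.partition (D |: Q)%SET A.
    have DAD : (D :|: A :\: D)%SET = A.
      apply/finset.setP => y; rewrite finset.in_setU finset.in_setD.
      by have [/(fintype.subsetP DA)->|] := boolP (y \in D).
    have := finset.partitionU1 QA D0; rewrite DAD; apply.
    rewrite -finset.setI_eq0; apply/eqP/finset.setP => y.
    by rewrite !finset.inE; case: (y \in D).
  rewrite PA/= (finset.def_pblock (finset.partition_trivIset PA) _ xD) ?finset.setU11// eqxx/=.
  by rewrite finset.setU1K// DQ.
rewrite finset.big_setU1//= -QD; first by rewrite finset.setD11.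
Qed.

End set_partition_sums.

Section partition_of_sequence.
Context {I : finType} {T : Type} {R : realType}.
Variables (v : I -> T) (f : seq T -> R).

Let F (D : {set I}) := f [seq v i | i <- enum D].

Lemma enum_subset_filter (A D : {set I}) : D \subset A ->
  enum D = [seq i <- enum A | i \in D].
Proof.
move=> DA; rewrite /enum_mem -filter_predI; apply: eq_filter => i /=.
by apply/idP/andP => [iD|[]//]; split=> //; exact: (fintype.subsetP DA).
Qed.

Lemma enum_setD_filter (A D : {set I}) :
  enum (A :\: D)%SET = [seq i <- enum A | i \notin D].
Proof.
rewrite /enum_mem -filter_predI; apply: eq_filter => i /=.
by rewrite finset.in_setD.
Qed.

Lemma setpart_sum_psum (A : {set I}) :
  setpart_sum F A = psum f [seq v i | i <- enum A].
Proof.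
have [n] := ubnP #|A|; elim: n A => // n ih A; rewrite ltnS => An.
case eA: (enum A) => [|x s].
  by rewrite (_ : A = finset.set0) ?setpart_sum0//; apply/eqP;
    rewrite -cards_eq0 cardE eA.
have xA : x \in A by rewrite -(mem_enum A) eA mem_head.
have /= /andP[xs us] : uniq (x :: s) by rewrite -eA enum_uniq.
(* subsets of A containing x correspond to masks of the other entries *)
pose mk (D : {set I}) := map_tuple (fun i => i \in D) (in_tuple s).
pose un (m : (size s).-tuple bool) := finset (fun i => i \in x :: mask m s).
have unK m : mk (un m) = m.
  apply: val_inj => /=; apply: (@eq_from_nth _ false).
    by rewrite size_map size_tuple.
  move=> k; rewrite size_map => ks; rewrite (nth_map x)// finset.inE inE.
  rewrite (negPf (memPn xs _ _)) ?mem_nth//= in_mask//.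
  by rewrite mem_nth// index_uniq.
rewrite (setpart_sum_block F xA) /= (@psum_cons _ _ _ _ _ (size s)) ?size_map//.
rewrite [RHS](reindex_onto mk un) => [|m _]; last exact: unK.
apply: eq_big => D.
  apply/idP/eqP => [/andP[xD DA]|<-].
    apply/finset.setP => i; rewrite finset.inE -filter_mask inE mem_filter.
    have [iD|iD] := boolP (i \in D).
      have : i \in x :: s by rewrite -eA mem_enum (fintype.subsetP DA).
      by rewrite inE.
    by rewrite /= orbF; apply/eqP => ix; rewrite ix xD in iD.
  rewrite finset.inE mem_head/=; apply/fintype.subsetP => i.
  rewrite finset.inE -(mem_enum A) eA !inE => /orP[->//|/mem_mask ->].
  by rewrite orbT.
move=> /andP[xD DA].
have eD : enum D = x :: mask (mk D) s.
  by rewrite (enum_subset_filter DA) eA/= xD -filter_mask.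
have eC : enum (A :\: D)%SET = mask (map negb (mk D)) s.
  by rewrite enum_setD_filter eA/= xD/= -map_comp -filter_mask.
rewrite ih; last first.
  rewrite (leq_trans _ An)// proper_card//; apply/properP; split.
    exact: finset.subsetDl.
  by exists x => //; rewrite finset.in_setD xD.
by rewrite /F eD eC/= !map_mask.
Qed.

End partition_of_sequence.

Section correlation_sums.
Context {R : realType} {d : nat}.
Local Notation pt := (stpoint R d).
Implicit Types rho xi : forall n, n.-tuple pt -> R.

(** Evaluating a family indexed by sizes on sequences removes the casts between
    tuples of provably equal sizes. *)
Definition seqfun xi (s : seq pt) : R := xi (size s) (in_tuple s).

Lemma seqfunE xi n (v : n.-tuple pt) : seqfun xi v = xi n v.
Proof.
case: v => s sn; have e := eqP sn; case: n / e sn => sn; rewrite /seqfun/=.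
by congr (xi _ _); exact: val_inj.
Qed.

Lemma val_subtuple n (v : n.-tuple pt) (D : {set 'I_n}) :
  subtuple v D = [seq tnth v i | i <- enum D] :> seq pt.
Proof.
rewrite /subtuple/= map_comp; congr map.
case: n v D => [|n] _ D.
  have nil (s : seq 'I_0) : s = [::] by case: s => [|[]].
  by rewrite [LHS]nil [RHS]nil.
apply: (@eq_from_nth _ ord0); first by rewrite size_map size_enum_ord -cardE.
move=> k; rewrite size_map size_enum_ord => kD.
rewrite (nth_map (Ordinal kD)) ?size_enum_ord// (enum_val_nth ord0).
by rewrite nth_enum_ord.
Qed.

Lemma correlation_psum rho xi n (v : n.-tuple pt) : correlation_functions rho xi ->
  (0 < n)%N -> reweighted_density rho v = psum (seqfun xi) v.
Proof.
move=> [_ /(_ n v) h] n0; rewrite h//.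
transitivity (setpart_sum (fun D : {set 'I_n} => seqfun xi [seq tnth v i | i <- enum D])
    [set: 'I_n]%SET).
  rewrite /setpart_sum; under eq_bigr do rewrite big_mkcondr/=.
  rewrite exchange_big/=; apply: eq_bigr => P PT.
  have P0 : (0 < #|P| < n.+1)%N.
    rewrite ltnS; apply/andP; split.
      rewrite card_gt0; apply/eqP => P0.
      have := finset.cover_partition PT; rewrite P0 /finset.cover big_set0 => /finset.setP.
      by move=> /(_ (Ordinal n0)); rewrite !inE.
    rewrite -[leqRHS]card_ord -finset.cardsT (card_partition PT) -sum1_card.
    by apply: leq_sum => D DP; rewrite card_gt0 (finset.partition_neq0 PT).
  rewrite -big_mkcond/=; under eq_bigl do rewrite eq_sym.
  rewrite big_nat1_eq P0; apply: eq_bigr => D _.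
  by rewrite -seqfunE val_subtuple.
rewrite setpart_sum_psum; congr psum; rewrite enum_setT -enumT; exact: map_tnth_enum.
Qed.

End correlation_sums.

(** * Numerical series *)

Section series_lemmas.
Context {R : realType}.
Implicit Types a b : R^nat.

(** Cauchy's root test.  The convention 0^-1 = 0 makes the term n = 0 of the limsup
    equal to 1 for every value of u 0. *)
Lemma root_test (u : (\bar R)^nat) b :
  (forall n, (0 < n)%N -> u n = (b n)%:E) ->
  (forall n, 0 <= b n) ->
  (limn_esup (fun n => u n `^ (n%:R^-1)) < 1)%E -> cvgn (series b).
Proof.
move=> ub b0; rewrite limn_esup_lim.
have /cvg_lim -> // := @cvg_esups_inf R (fun n => u n `^ (n%:R^-1))%E.
move=> /ereal_inf_lt[e [N _ Ne] e1].
have e0 : (0 <= e)%E.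
  rewrite -Ne; apply: (@le_trans _ _ (u N `^ (N%:R^-1))%E); first exact: poweR_ge0.
  by apply: ereal_sup_ubound; exists N => //=.
have [r er] : exists r, e = r%:E.
  by exists (fine e); rewrite fineK// ge0_fin_numE// (lt_trans e1)// ltry.
move: e0 e1; rewrite er lee_fin lte_fin => r0 r1.
pose q := (r + 1) / 2; have q0 : 0 < q by rewrite /q; lra.
have q1 : `|q| < 1 by rewrite ger0_norm ?ltW// /q; lra.
have rq : r <= q by rewrite /q; lra.
have bq n : (N < n)%N -> b n <= q ^+ n.
  move=> Nn; have n0 := leq_ltn_trans (leq0n N) Nn.
  have : (u n `^ (n%:R^-1) <= q%:E)%E.
    apply: (@le_trans _ _ e); last by rewrite er lee_fin.
    rewrite -Ne; apply: ereal_sup_ubound; exists n => //=; exact: ltnW.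
  move=> /(gt0_ler_poweR (ler0n R n)).
  rewrite !in_itv/= poweR_ge0 leey lee_fin (ltW q0) leey => /(_ isT isT).
  rewrite -poweRrM mulVf ?pnatr_eq0 -?lt0n// ub// poweRe1; last by rewrite lee_fin.
  rewrite /= lee_fin.
  by rewrite (powR_mulrn n (ltW q0)).
(* C makes the geometric bound hold for the first terms too *)
pose C := 1 + \sum_(k < N.+1) b k / q ^+ k.
have C1 : 1 <= C by rewrite lerDl sumr_ge0// => k _; rewrite divr_ge0 ?exprn_ge0// ltW.
apply: (@series_le_cvg _ _ (geometric C q)) => //; last 1 first.
- exact: is_cvg_geometric_series.
- move=> n.
  by rewrite /geometric/= mulr_ge0 ?exprn_ge0 ?(ltW q0)// (le_trans ler01).
move=> n; rewrite /geometric/=; have [nN|Nn] := leqP n N.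
  rewrite -ler_pdivrMr ?exprn_gt0// /C.
  rewrite (bigD1 (Ordinal (nN : (n < N.+1)%N)))//= addrCA lerDl addr_ge0//.
  by rewrite sumr_ge0// => k _; rewrite divr_ge0 ?exprn_ge0// ltW.
by rewrite (le_trans (bq n Nn))// ler_peMl ?exprn_ge0// ltW.
Qed.

Lemma nneseries_lty a : (forall n, 0 <= a n) -> cvgn (series a) ->
  (\sum_(n <oo) (a n)%:E < +oo)%E.
Proof.
move=> a0 ca.
have -> : (fun n => (\sum_(0 <= i < n) (a i)%:E)%E) = EFin \o series a.
  by apply/funext => n; rewrite sumEFin.
by rewrite EFin_lim// ltry.
Qed.

Lemma cvg_series_shift a (l : R) : series (fun n => a n.+1) @ \oo --> l ->
  series a @ \oo --> a 0%N + l.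
Proof.
move=> h; rewrite -cvg_shiftS.
rewrite (_ : [sequence _]_n = (fun n => a 0%N + series (fun n => a n.+1) n)).
  by apply: cvgD => //; exact: cvg_cst.
by apply/funext => n; rewrite /series/= big_nat_recl.
Qed.

Definition cauchy_product a b : R^nat :=
  fun n => \sum_(k < n.+1) a k * b (n - k)%N.

Lemma series_cauchy_product a b N : series (cauchy_product a b) N =
  \sum_(k < N) \sum_(l < N - k) a k * b l.
Proof.
rewrite /series/= big_mkord; elim: N => [|N ih]; first by rewrite !big_ord0.
rewrite big_ord_recr/= ih [in LHS]/cauchy_product.
have -> : \sum_(k < N) \sum_(l < N - k) a k * b l =
          \sum_(k < N.+1) \sum_(l < N - k) a k * b l.
  by rewrite big_ord_recr/= subnn big_ord0 addr0.
rewrite -big_split/=; apply: eq_bigr => k _.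
by rewrite (subSn (leq_ord k)) big_ord_recr.
Qed.

Lemma series_mul_sub_cauchy a b N :
  series a N * series b N - series (cauchy_product a b) N =
  \sum_(k < N) \sum_(l < N | (N - k <= l)%N) a k * b l.
Proof.
rewrite series_cauchy_product /series/= !big_mkord big_distrlr/= -sumrB.
apply: eq_bigr => k _; rewrite (bigID (fun l : 'I_N => (l < N - k)%N))/=.
rewrite (big_ord_widen N (fun l => a k * b l) (leq_subr k N)).
by rewrite addrAC subrr add0r; apply: eq_bigl => l; rewrite -leqNgt.
Qed.

Lemma series_ge0_nd a : (forall n, 0 <= a n) -> {homo series a : n m / (n <= m)%N >-> n <= m}.
Proof. by move=> a0; exact: nondecreasing_series. Qed.

Lemma cauchy_product_ge0 a b : (forall n, 0 <= a n) -> (forall n, 0 <= b n) ->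
  forall n, 0 <= cauchy_product a b n.
Proof. by move=> a0 b0 n; rewrite sumr_ge0// => k _; rewrite mulr_ge0. Qed.

(** The square with side N lies between the triangles with sides N and 2N, so
    monotone convergence identifies the limit. *)
Lemma cauchy_product_cvg_ge0 a b : (forall n, 0 <= a n) -> (forall n, 0 <= b n) ->
  cvgn (series a) -> cvgn (series b) ->
  series (cauchy_product a b) @ \oo --> limn (series a) * limn (series b).
Proof.
move=> a0 b0 ca cb; set c := cauchy_product a b.
have c0 := cauchy_product_ge0 a0 b0.
have cab : (fun N => series a N * series b N) @ \oo --> limn (series a) * limn (series b).
  exact: cvgM.
have le1 N : series c N <= series a N * series b N.
  rewrite -subr_ge0 series_mul_sub_cauchy sumr_ge0// => k _.
  by rewrite sumr_ge0// => l _; rewrite mulr_ge0.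
have le2 N : series a N * series b N <= series c (N + N).
  rewrite series_cauchy_product /series/= !big_mkord big_distrlr/=.
  rewrite big_split_ord/= ler_wpDr//.
    by rewrite sumr_ge0// => k _; rewrite sumr_ge0// => l _; rewrite mulr_ge0.
  apply: ler_sum => k _.
  rewrite -(addnBA _ (ltnW (ltn_ord k))) big_split_ord/= lerDl.
  by rewrite sumr_ge0// => l _; rewrite mulr_ge0.
have la0 : 0 <= limn (series a).
  by apply: limr_ge => //; apply: nearW => n; rewrite sumr_ge0.
have ub N : series c N <= limn (series a) * limn (series b).
  apply: le_trans (le1 N) _; apply: ler_pM; rewrite ?sumr_ge0//.
    by apply: nondecreasing_cvgn_le => //; exact: series_ge0_nd.
  by apply: nondecreasing_cvgn_le => //; exact: series_ge0_nd.
have cc : cvgn (series c).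
  apply: nondecreasing_is_cvgn; first exact: series_ge0_nd.
  by exists (limn (series a) * limn (series b)) => _ [N _ <-].
suff <- : limn (series c) = limn (series a) * limn (series b) by [].
apply/le_anti/andP; split; first by apply: limr_le => //; exact: nearW.
rewrite -(cvg_lim _ cab)//; apply: limr_le; first by apply/cvg_ex; eexists; exact: cab.
apply: nearW => N; apply: le_trans (le2 N) _.
by apply: nondecreasing_cvgn_le => //; exact: series_ge0_nd.
Qed.

(** The error of the truncated Cauchy product is bounded by the error for the
    absolute values, which vanishes by monotone convergence. *)
Lemma cauchy_product_cvg a b :
  cvgn (series (fun n => `|a n|)) -> cvgn (series (fun n => `|b n|)) ->
  series (cauchy_product a b) @ \oo --> limn (series a) * limn (series b).
Proof.
move=> ca cb; pose na n := `|a n|; pose nb n := `|b n|.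
have na0 n : 0 <= na n by rewrite normr_ge0.
have nb0 n : 0 <= nb n by rewrite normr_ge0.
have h := cauchy_product_cvg_ge0 na0 nb0 ca cb.
have hn : (fun N => series na N * series nb N) @ \oo -->
    limn (series na) * limn (series nb) by exact: cvgM ca cb.
have e0 : (fun N => series na N * series nb N - series (cauchy_product na nb) N)
    @ \oo --> (0 : R).
  by rewrite -[X in _ --> X](subrr (limn (series na) * limn (series nb)));
    exact: cvgB hn h.
have hab : (fun N => series a N * series b N) @ \oo --> limn (series a) * limn (series b).
  by apply: cvgM; exact: normed_cvg.
have d0 : (fun N => series a N * series b N - series (cauchy_product a b) N) @ \oo --> (0 : R).
  apply: norm_cvg0; apply: (squeeze_cvgr _ (cvg_cst 0) e0); apply: nearW => N.
  rewrite normr_ge0/= !series_mul_sub_cauchy.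
  apply: le_trans (ler_norm_sum _ _ _) _; apply: ler_sum => k _.
  apply: le_trans (ler_norm_sum _ _ _) _; apply: ler_sum => l _.
  by rewrite normrM.
rewrite (_ : series (cauchy_product a b) = (fun N => series a N * series b N -
   (series a N * series b N - series (cauchy_product a b) N))).
  by rewrite -[X in _ --> X]subr0; exact: cvgB hab d0.
by apply/funext => N; rewrite opprB addrCA subrr addr0.
Qed.

End series_lemmas.

Section mask_count.

Lemma sum_tuple_boolS (R : realType) n (H : bitseq -> R) :
  \sum_(m : n.+1.-tuple bool) H m =
  \sum_(m : n.-tuple bool) H (true :: m) + \sum_(m : n.-tuple bool) H (false :: m).
Proof.
rewrite (reindex (fun p : bool * n.-tuple bool => [tuple of p.1 :: p.2])); last first.
  exists (fun m => (thead m, [tuple of behead m])) => [[b m] _|m _].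
    by congr pair; exact: val_inj.
  by rewrite [RHS]tuple_eta.
by rewrite -(pair_bigA _ (fun b (m : n.-tuple bool) => H (b :: m)))/= big_bool.
Qed.

(** Splitting on the first bit of the mask is Pascal's rule. *)
Lemma sum_masks (R : realType) n (G : nat -> nat -> R) :
  \sum_(m : n.-tuple bool) G (count id m) (count negb m) =
  \sum_(k < n.+1) 'C(n, k)%:R * G k (n - k)%N.
Proof.
elim: n G => [|n ih] G.
  rewrite big_ord_recl big_ord0 addr0 bin0 mul1r subnn.
  rewrite (big_pred1 [tuple])// => m /=; rewrite (tuple0 m); exact/esym/eqP.
rewrite (sum_tuple_boolS n (fun m => G (count id m) (count negb m)))/=.
rewrite (ih (fun k l => G k.+1 l)) (ih (fun k l => G k l.+1)).
rewrite [RHS]big_ord_recl/= bin0 subn0.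
under [in RHS]eq_bigr do rewrite /bump/= add1n binS natrD mulrDl subSS.
rewrite big_split/= addrA [in RHS]addrC; congr (_ + _).
rewrite [in LHS]big_ord_recl/= bin0 subn0 [in RHS]big_ord_recr/= bin_small// mul0r addr0.
congr (_ + _); apply: eq_bigr => k _; rewrite /bump/= add1n.
by rewrite subnSK.
Qed.

End mask_count.

(** * The reweighted densities as translation-invariant partition sums *)

Section psum_measurable.
Context dd (T : measurableType dd) (R : realType).

Lemma measurable_tuple0 d' (V : measurableType d') (g : 0.-tuple T -> V) :
  measurable_fun setT g.
Proof.
rewrite (_ : g = cst (g [tuple])); first exact: measurable_cst.
by apply/funext => v; rewrite (tuple0 v).
Qed.

Lemma psum_rec_cons k (f : seq T -> R) x (s : seq T) n : size s = n ->
  psum_rec k.+1 f (x :: s) =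
  \sum_(m : n.-tuple bool) f (x :: mask m s) * psum_rec k f (mask (map negb m) s).
Proof. by move=> <-. Qed.

Lemma mseq_psum (f : seq T -> R) : mseq f -> mseq (psum f).
Proof.
move=> mf; have mrec k : mseq (psum_rec k f).
  elim: k => [|k ih] n; first exact: measurable_cst.
  case: n => [|n]; first exact: measurable_tuple0.
  rewrite (_ : (fun _ => _) = (fun v : n.+1.-tuple T => \sum_(m : n.-tuple bool)
      f (mask (true :: m) v) * psum_rec k f (mask (false :: map negb m) v))).
    apply: measurable_sum => m; apply: measurable_funM.
      by apply: (mseq_mask mf); rewrite /= size_tuple.
    by apply: (mseq_mask ih); rewrite /= size_map size_tuple.
  by apply/funext => -[[|x s]//= sz]; apply: psum_rec_cons; apply/eqP.
move=> n; rewrite (_ : (fun _ => _) = (fun v : n.-tuple T => psum_rec n f v)).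
  exact: mrec.
by apply/funext => v; rewrite /psum size_tuple.
Qed.

End psum_measurable.

Section reweighting.
Context {R : realType} {d : nat}.
Local Notation pt := (stpoint R d).
Local Notation pm n := (power_measure (@leb R d) n).
Variables (rho xi xi' : forall n, n.-tuple pt -> R).

Let f := seqfun xi'.

Lemma val_tshift n (v : n.-tuple pt) c : tshift v c = map (padd ^~ c) v :> seq pt.
Proof.
by rewrite /tshift/= -[in RHS](map_tnth_enum v) -map_comp.
Qed.

Hypothesis xi'_version : invariant_version xi xi'.

Lemma mseq_version : mseq f.
Proof.
move=> [|k]; first exact: measurable_tuple0.
rewrite (_ : (fun _ => _) = @xi' k.+1); first by have [] := xi'_version (ltn0Sn k).
by apply/funext => v; exact: seqfunE.
Qed.

Lemma version_shift c x s : f (map (padd ^~ c) (x :: s)) = f (x :: s).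
Proof.
have [_ h _] := xi'_version (ltn0Sn (size s)).
have := h (in_tuple (x :: s)) c; by rewrite -!seqfunE val_tshift.
Qed.

Lemma psum_shift c s : psum f (map (padd ^~ c) s) = psum f s.
Proof. by apply: psum_map => x s'; exact: version_shift. Qed.

(** Each block function changes on a null set only, and there are finitely many
    blocks. *)
Lemma reweighted_psum_ae n : correlation_functions rho xi -> (0 < n)%N ->
  {ae pm n, forall v : n.-tuple pt, reweighted_density rho v = psum f v}.
Proof.
move=> cor n0.
have h (m : n.-tuple bool) : {ae pm n, forall v : n.-tuple pt,
    (0 < count id m)%N -> seqfun xi (mask m v) = f (mask m v)}.
  have [m0|m0] := posnP (count id m).
    by apply: aeW.
  have [_ _ ae] := xi'_version m0.
  have ae' : {ae pm (count id m), forall v : (count id m).-tuple pt, seqfun xi v = f v}.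
    by apply: filterS ae => v; rewrite /f !seqfunE => ->.
  have := ae_mask (P := fun s => seqfun xi s = f s) (size_tuple m) ae'.
  by apply: filterS => v.
have {}h : {ae pm n, forall v : n.-tuple pt, forall m : n.-tuple bool,
    (0 < count id m)%N -> seqfun xi (mask m v) = f (mask m v)}.
  by apply: filter_forall => m; exact: h.
apply: filterS h => v hv.
rewrite (correlation_psum v cor n0).
apply: (eq_psum (P := fun s => subseq s v)) => //.
  by move=> s m sv; apply: subseq_trans (mask_subseq _ _) sv.
move=> x s /subseqP[m sm xs].
have szm : size m == n by rewrite sm size_tuple.
rewrite xs; apply: (hv (Tuple szm)) => /=.
by rewrite -(size_mask sm) -xs.
Qed.

End reweighting.

(** * Windows around a point *)

Lemma measurable_all_tnth dd (T : measurableType dd) n (A : set T) :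
  measurable A -> measurable [set v : n.-tuple T | forall i, A (tnth v i)].
Proof.
move=> mA.
rewrite (_ : mkset _ = \bigcap_(i in [set: 'I_n]) ((fun v => tnth v i) @^-1` A)).
  apply: fin_bigcap_measurable => // i _; rewrite -[X in measurable X]setTI.
  exact: (@measurable_tnth _ _ n i).
by apply/seteqP; split => [v Bv i _|v Bv i]; [exact: Bv|exact: (Bv i)].
Qed.

Section indicator_products.
Context {R : realType} {d : nat}.
Local Notation pt := (stpoint R d).
Implicit Types (A : set pt) (s : seq pt).

Definition ones A s : R := \prod_(z <- s) \1_A z.

Lemma ones_ge0 A s : 0 <= ones A s.
Proof. by rewrite /ones prodr_ge0. Qed.

Lemma ones_cons A x s : ones A (x :: s) = \1_A x * ones A s.
Proof. by rewrite /ones big_cons. Qed.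

Lemma ones_mask A (m : bitseq) s : size m = size s ->
  ones A s = ones A (mask m s) * ones A (mask (map negb m) s).
Proof.
elim: s m => [|x s ih] [|b m]//=; first by rewrite /ones !big_nil mulr1.
move=> [ms]; rewrite ones_cons (ih m)//.
by case: b => /=; rewrite ones_cons; [rewrite mulrA|rewrite mulrCA].
Qed.

Lemma ones_tpow n A (v : n.-tuple pt) : ones A v = \1_(tpow A) v.
Proof.
rewrite /ones big_tuple indicE; have [/[!inE] Av|nAv] := boolP (v \in _).
  by rewrite big1// => i _; rewrite indicE mem_set//; exact: Av.
have [i nA] : exists i, ~ A (tnth v i).
  by apply/existsNP => Av; move/negP: nAv; apply; rewrite inE.
by rewrite (bigD1 i)//= indicE memNset// mul0r.
Qed.

Lemma mseq_ones A : measurable A -> mseq (ones A).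
Proof.
move=> mA k; rewrite (_ : (fun _ => _) = (fun v : k.-tuple pt => \prod_(i < k) \1_A (tnth v i))).
  apply: measurable_prod => i _.
  have m1 : measurable_fun setT (\1_A : pt -> R) by exact: measurable_indic.
  exact: (measurableT_comp m1 (measurable_tnth i)).
by apply/funext => v; rewrite /ones big_tuple.
Qed.

Lemma measurable_tpow n A : measurable A -> measurable (tpow A : set (n.-tuple pt)).
Proof. exact: measurable_all_tnth. Qed.

End indicator_products.

Section point_shifts.
Context {R : realType} {d : nat}.
Local Notation pt := (stpoint R d).
Implicit Types y z c : pt.

Lemma padd_origin y : padd (origin : pt) y = y.
Proof.
case: y => y1 y2; congr pair; last by rewrite /= add0r.
by apply: eq_from_tnth => i; rewrite !tnth_mktuple add0r.
Qed.

Lemma cyl_psub_padd (r t : R) w y : cyl r t (psub y (padd w y)) <-> cyl r t w.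
Proof.
rewrite /cyl/= /enorm; have -> : y.2 - (w.2 + y.2) = - w.2 :> R by ring.
rewrite normrN (eq_bigr (fun i => (tnth w.1 i : R) ^+ 2))// => i _.
by rewrite !tnth_mktuple -[RHS]sqrrN; congr (_ ^+ 2); ring.
Qed.

Lemma indic_cyl_psub_padd (r t : R) w y :
  \1_(cyl r t) (psub y (padd w y)) = \1_(cyl r t) w :> R.
Proof.
rewrite !indicE; congr (nat_of_bool _)%:R.
by apply/idP/idP; rewrite !inE => /cyl_psub_padd.
Qed.

Lemma measurable_psub : measurable_fun setT (fun p : pt * pt => psub p.1 p.2).
Proof.
apply: measurable_fun_pair.
  apply/measurable_fun_tnthP => i.
  rewrite (_ : _ \o _ = (fun p : pt * pt => (tnth p.1.1 i : R) - tnth p.2.1 i)); last first.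
    by apply/funext => p; rewrite /= tnth_mktuple.
  have mi := @measurable_tnth _ (measurableTypeR R) d i.
  apply: measurable_funB.
    exact: (measurableT_comp mi (measurableT_comp measurable_fst measurable_fst)).
  exact: (measurableT_comp mi (measurableT_comp measurable_fst measurable_snd)).
apply: measurable_funB.
  exact: (measurableT_comp measurable_snd measurable_fst).
exact: (measurableT_comp measurable_snd measurable_snd).
Qed.

End point_shifts.

Section unit_box.
Context {R : realType} {d : nat}.
Local Notation pt := (stpoint R d).

Lemma power_measure_box dd (T : measurableType dd)
    (mu : {sigma_finite_measure set T -> \bar R}) (A : set T) n :
  measurable A -> mu A = 1%E ->
  exists2 B : set (n.-tuple T), measurable B &
    power_measure mu n B = 1%E /\ forall v, B v -> forall i, A (tnth v i).
Proof.
move=> mA A1; pose B := [set v : n.-tuple T | forall i, A (tnth v i)].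
have mB : measurable B by exact: measurable_all_tnth.
exists B => //; split => //.
elim: n @B mB => [|n ih] B mB.
  by rewrite /= diracE mem_set// => -[].
pose B' := [set v : n.-tuple T | forall i, A (tnth v i)].
have mB' : measurable B' by exact: measurable_all_tnth.
rewrite -[LHS]/((mu \x power_measure mu n)%E (@tcons _ T n @^-1` B)).
rewrite (_ : _ @^-1` B = A `*` B').
  by rewrite product_measure1E// [X in (X * _)%E]A1 [X in (_ * X)%E](ih mB') mule1.
apply/seteqP; split => -[x v] /=; first by move/all_tnth_tcons.
by move=> [Ax Bv]; apply/all_tnth_tcons.
Qed.

Lemma leb_unit_box : exists2 A : set pt, measurable A & bounded A /\ leb A = 1%E.
Proof.
have i1 : @lebesgue_measure R `[0, 1]%classic = 1%E.
  by rewrite lebesgue_measure_itv/= lte_fin ltr01 oppr0 adde0.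
have [B mB [B1 BI]] :=
  @power_measure_box _ _ (@lebesgue_measure R) _ d (measurable_itv `[0, 1]%R) i1.
exists (B `*` `[0, 1]%classic); first exact: measurableX.
split; last first.
  rewrite -[LHS]/((power_measure (@lebesgue_measure R) d \x (@lebesgue_measure R))%E _).
  by rewrite product_measure1E// [X in (X * _)%E]B1 [X in (_ * X)%E]i1 mule1.
exists (d%:R + 1) => -[y1 y2] [/= By]; rewrite in_itv/= => /andP[y20 y21]; split => /=.
  apply: le_trans (enorm_le_sum _) _.
  apply: (@le_trans _ _ (\sum_(i < d) 1)).
    apply: ler_sum => i _; have /= := BI _ By i; rewrite in_itv/= => /andP[h0 h1].
    by rewrite ger0_norm.
  by rewrite sumr_const card_ord lerDl.
by rewrite ger0_norm// (le_trans y21)// lerDr.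
Qed.

End unit_box.

(** * Moments of the process and of its Palm distributions *)

Section moments.
Context {R : realType} {d : nat} {dO : measure_display} {Omega : measurableType dO}.
Variables (Pr : probability Omega R) (Y : {RV Pr >-> config R d})
  (rho : forall n, n.-tuple (stpoint R d) -> R) (r t : R).
Hypotheses (rhoY : product_densities Y rho) (lb_gt0 : 0 < lambda_bar rho).
Local Notation pt := (stpoint R d).
Local Notation pm n := (power_measure (@leb R d) n).
Local Notation lb := (lambda_bar rho).
Local Notation lam := (intensity rho).
Local Notation rew := (reweighted_density rho).
Local Notation u := (u_fun rho r t).

Definition cyl_at (y : pt) : set pt := [set z | cyl r t (psub y z)].

Lemma intensity_ge0 y : 0 <= lam y.
Proof. by have [_ + _ _ _] := rhoY (ltn0Sn 0); apply. Qed.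

Lemma lambda_bar_le y : lb <= lam y.
Proof. by apply: ge_inf; [exists 0 => _ [z _ <-]; exact: intensity_ge0|exists y]. Qed.

Lemma intensity_gt0 y : 0 < lam y.
Proof. exact: lt_le_trans lb_gt0 (lambda_bar_le y). Qed.

Lemma measurable_intensity : measurable_fun setT (lam : pt -> R).
Proof.
have [m1 _ _ _ _] := rhoY (ltn0Sn 0).
apply: (measurableT_comp m1 (g := fun y => [tuple y])).
by apply/measurable_fun_tnthP => i; rewrite (ord1 i); exact: measurable_id.
Qed.

Lemma prod_intensity_gt0 n (v : n.-tuple pt) : 0 < \prod_(i < n) lam (tnth v i).
Proof. by apply: prodr_gt0 => i _; exact: intensity_gt0. Qed.

Lemma reweighted_ge0 n (v : n.-tuple pt) : (0 < n)%N -> 0 <= rew v.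
Proof.
by move=> /rhoY[_ h _ _ _]; rewrite divr_ge0// ltW// prod_intensity_gt0.
Qed.

Lemma measurable_reweighted n : (0 < n)%N ->
  measurable_fun setT (fun v : n.-tuple pt => rew v).
Proof.
move=> n0; have [m1 _ _ _ _] := rhoY n0; apply: measurable_funM => //.
apply: (@measurable_invr_ge0 _ _ _ (fun v : n.-tuple pt => \prod_(i < n) lam (tnth v i))).
  by move=> v; exact/ltW/prod_intensity_gt0.
apply: measurable_prod => i _.
exact: (measurableT_comp measurable_intensity (measurable_tnth i)).
Qed.

(** The intensity is at least lambda_bar, so reweighting multiplies the factorial
    moment by at most lambda_bar^-n. *)
Lemma reweighted_moment_lty n (B : set pt) : (0 < n)%N -> measurable B -> bounded B ->
  (\int[pm n]_v (ones B v * rew v)%:E < +oo)%E.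
Proof.
move=> n0 mB bB; have [mr r0 _ fm cam] := rhoY n0.
have := fm _ mB bB; rewrite /factorial_moment cam; last 2 first.
- by apply/measurable_EFinP; apply: measurable_indic; exact: measurable_tpow.
- by move=> v; rewrite lee_fin.
move=> I.
have mo : measurable_fun setT (fun v : n.-tuple pt => ones B v) by exact: mseq_ones.
apply: (@le_lt_trans _ _ (\int[pm n]_v
   (((lb ^+ n)^-1)%:E * ((\1_(tpow B) v)%:E * (rho v)%:E)))%E).
  apply: ge0_le_integral => //.
  - by move=> v _; rewrite lee_fin mulr_ge0 ?ones_ge0// reweighted_ge0.
  - by apply/measurable_EFinP; apply: measurable_funM => //; exact: measurable_reweighted.
  - do 2!apply: emeasurable_funM => //; apply/measurable_EFinP => //.
    by apply: measurable_indic; exact: measurable_tpow.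
  move=> v _; rewrite -!EFinM lee_fin ones_tpow [leRHS]mulrCA ler_wpM2l//.
  rewrite /reweighted_density mulrC ler_wpM2r//.
  rewrite lef_pV2 ?posrE ?exprn_gt0 ?prod_intensity_gt0//.
  rewrite -[X in lb ^+ X](card_ord n) -prodr_const.
  by apply: ler_prod => i _; rewrite lambda_bar_le ltW.
rewrite ge0_integralZl//.
- by rewrite lte_mul_pinfty// lee_fin invr_ge0 exprn_ge0// ltW.
- apply: emeasurable_funM => //; apply/measurable_EFinP => //.
  by apply: measurable_indic; exact: measurable_tpow.
- by move=> v _; rewrite mule_ge0// lee_fin.
- by rewrite lee_fin invr_ge0 exprn_ge0// ltW.
Qed.

Lemma u_funE y z : u y z = lb / lam z * \1_(cyl_at y) z.
Proof. by rewrite /u_fun mulrAC. Qed.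

Lemma u_fun_ge0 y z : 0 <= u y z.
Proof. by rewrite /u_fun divr_ge0 ?intensity_ge0// mulr_ge0// ltW. Qed.

Lemma measurable_u_fun : measurable_fun setT (fun p : pt * pt => u p.1 p.2).
Proof.
apply: measurable_funM.
  apply: measurable_funM => //.
  have m1 : measurable_fun setT (\1_(cyl r t) : pt -> R).
    by apply: measurable_indic; exact: measurable_cyl.
  exact: (measurableT_comp m1 measurable_psub).
apply: (@measurable_invr_ge0 _ _ _ (fun p : pt * pt => lam p.2)).
  by move=> p; exact: intensity_ge0.
exact: (measurableT_comp measurable_intensity measurable_snd).
Qed.

Lemma u_fun_bounded y : bounded [set z | u y z != 0].
Proof.
have [N _ yN] : (\bigcup_k (cyl k%:R k%:R : set pt)) y by rewrite bigcup_cyl.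
have [M HM] := @cyl_psub_bounded R d N%:R N%:R r t.
exists M => z /= uz; apply: HM yN _; apply: contrapT => nz.
by move/eqP: uz; apply; rewrite u_funE indicE memNset// mulr0.
Qed.

Lemma prod_u_fun n (v : n.-tuple pt) y : \prod_(i < n) u y (tnth v i) =
  lb ^+ n * (ones (cyl_at y) v / \prod_(i < n) lam (tnth v i)).
Proof.
rewrite /ones big_tuple (eq_bigr _ (fun i _ => u_funE y (tnth v i))) big_split/=.
rewrite big_split/= prodr_const card_ord.
rewrite (big_morph _ (@invfM R) (invr1 R)) -!mulrA; congr (_ * _).
by rewrite mulrC.
Qed.

Lemma prod_u_rho n (v : n.-tuple pt) y :
  \prod_(i < n) u y (tnth v i) * rho v = lb ^+ n * (ones (cyl_at y) v * rew v).
Proof.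
rewrite prod_u_fun /reweighted_density -!mulrA; congr (_ * (_ * _)).
exact: mulrC.
Qed.

Lemma measurable_tuple_sum_u n : measurable_fun setT
  (fun p : pt * config R d => tuple_sum n (atoms p.2) (u p.1)).
Proof.
apply: (measurable_esum_tuples (pi := snd)
  (h := fun p => (\prod_(i < n) u p.1.1 (tnth p.2 i))%:E)).
- exact: measurable_snd.
- apply/measurable_EFinP; apply: measurable_prod => i _.
  apply: (measurableT_comp measurable_u_fun (g := fun p : pt * config R d * n.-tuple pt =>
    (p.1.1, tnth p.2 i))).
  apply: measurable_fun_pair.
    exact: (measurableT_comp measurable_fst measurable_fst).
  exact: (measurableT_comp (measurable_tnth i) measurable_snd).
- by move=> p; rewrite lee_fin prodr_ge0// => i _; exact: u_fun_ge0.
Qed.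

Lemma tuple_sum0 A (w : pt -> R) : tuple_sum 0 A w = 1%E.
Proof. by rewrite /tuple_sum dtuples0 esum_set1 big_ord0. Qed.

Lemma tuple_sum_moment n y : (0 < n)%N ->
  (\int[distribution Pr Y]_phi tuple_sum n (atoms phi) (u y) =
   \int[pm n]_v (lb ^+ n * (ones (cyl_at y) v * rew v))%:E)%E.
Proof.
move=> n0; have [_ _ _ _ cam] := rhoY n0.
have mt := measurable_slice y (measurable_tuple_sum_u n).
have pu v : 0 <= \prod_(i < n) u y (tnth v i).
  by apply: prodr_ge0 => i _; exact: u_fun_ge0.
rewrite (ge0_integral_pushforward (phi := Y))//; last first.
  by move=> phi _; apply: esum_ge0 => v _; rewrite lee_fin.
rewrite preimage_setT cam//; last first.
  apply/measurable_EFinP; apply: measurable_prod => i _.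
  exact: (measurableT_comp (measurable_slice y measurable_u_fun) (measurable_tnth i)).
by apply: eq_integral => v _; rewrite -EFinM prod_u_rho.
Qed.

End moments.

Section palm_moments.
Context {R : realType} {d : nat} {dO : measure_display} {Omega : measurableType dO}.
Variables (Pr : probability Omega R) (Y : {RV Pr >-> config R d})
  (rho : forall n, n.-tuple (stpoint R d) -> R) (r t : R).
Local Notation pt := (stpoint R d).
Local Notation pm n := (power_measure (@leb R d) n).
Local Notation lb := (lambda_bar rho).
Local Notation lam := (intensity rho).
Local Notation rew := (reweighted_density rho).
Local Notation u := (u_fun rho r t).
Local Notation S := (cyl r t : set pt).

(** The indicators left by a product of functions u_fun centred at the first
    point of a pattern, when that point is restricted to A. *)
Definition near_head (A : set pt) (s : seq pt) : R :=
  if s is y :: s' then \1_A y * ones (cyl_at r t y) s' else 0.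

Lemma near_head_ge0 A s : 0 <= near_head A s.
Proof. by case: s => //= y s; rewrite mulr_ge0 ?ones_ge0. Qed.

Lemma mseq_near_head A : measurable A -> mseq (near_head A).
Proof.
move=> mA [|n]; first exact: measurable_tuple0.
rewrite (_ : (fun _ => _) = (fun v : n.+1.-tuple pt => \1_A (thead v) *
    \prod_(i < n) \1_S (psub (thead v) (tnth [tuple of behead v] i)))); last first.
  by apply/funext => v; rewrite {1}(tuple_eta v) /= /ones big_tuple.
have mh : measurable_fun setT (fun v : n.+1.-tuple pt => thead v).
  exact: measurable_tnth.
have m1 : measurable_fun setT (\1_A : pt -> R) by exact: measurable_indic.
have mS : measurable_fun setT (\1_S : pt -> R).
  by apply: measurable_indic; exact: measurable_cyl.
apply: measurable_funM; first exact: (measurableT_comp m1 mh).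
apply: measurable_prod => i _; apply: (measurableT_comp mS).
apply: (measurableT_comp measurable_psub (g := fun v : n.+1.-tuple pt =>
  (thead v, tnth [tuple of behead v] i))).
apply: measurable_fun_pair => //.
exact: (measurableT_comp (measurable_tnth i) (measurable_behead (n := n))).
Qed.

Lemma ones_cyl_at_shift y (s : seq pt) :
  ones (cyl_at r t y) (map (padd ^~ y) s) = ones S s.
Proof.
rewrite /ones big_map; apply: eq_bigr => z _.
exact: indic_cyl_psub_padd.
Qed.

(** Moving the head of the pattern to the origin, Tonelli's theorem and
    translation invariance of Lebesgue measure separate the position of the
    head from the relative positions of the other points. *)
Lemma integral_near_head n (A : set pt) (h : seq pt -> R) : measurable A ->
  mseq h -> (forall s, 0 <= h s) ->
  (forall c x s, h (map (padd ^~ c) (x :: s)) = h (x :: s)) ->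
  (\int[pm n.+1]_v (near_head A v * h v)%:E =
   leb A * \int[pm n]_w (ones S w * h (origin :: w))%:E)%E.
Proof.
move=> mA mh h0 hc.
have mnh := mseq_mul (mseq_near_head mA) mh.
rewrite integral_powerS; last 2 first.
- exact: (mseq_EFin mnh (k := n.+1)).
- by move=> v; rewrite lee_fin mulr_ge0// near_head_ge0.
have mo : mseq (fun s => ones S s * h (origin :: s)).
  by apply: mseq_mul (mseq_cons _ mh); exact: (mseq_ones (measurable_cyl r t)).
have E y : (\int[pm n]_v (near_head A (tcons (y, v)) * h (tcons (y, v)))%:E =
    (\1_A y)%:E * \int[pm n]_w (ones S w * h (origin :: w))%:E)%E.
  rewrite -(integral_tshift y); last 2 first.
  - exact: (mseq_EFin (mseq_cons y mnh) (k := n)).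
  - by move=> v; rewrite lee_fin mulr_ge0// near_head_ge0.
  rewrite -ge0_integralZl//; last 2 first.
  - exact: (mseq_EFin mo (k := n)).
  - by move=> v _; rewrite lee_fin mulr_ge0// ones_ge0.
  apply: eq_integral => w _; rewrite /tcons/= val_tshift ones_cyl_at_shift.
  rewrite -EFinM -mulrA; congr ((_ * (_ * _))%:E).
  by rewrite -(hc y) /= padd_origin.
under eq_integral do rewrite E.
rewrite ge0_integralZr//.
- by congr (_ * _)%E; rewrite integral_indic ?setIT.
- by apply/measurable_EFinP; exact: measurable_indic.
- by apply: integral_ge0 => w _; rewrite lee_fin mulr_ge0// ones_ge0.
Qed.

Lemma atoms_remove_point (phi : config R d) (y : pt) :
  atoms (remove_point phi y) = atoms phi `\ y.
Proof.
apply/seteqP; split => z; rewrite /atoms/= /mrestr.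
  have [->|zy] := pselect (z = y); first by rewrite setICr measure0 ltxx.
  by move=> h; split=> //; rewrite (_ : [set z] `&` _ = [set z]) in h => //;
    apply/seteqP; split => [w []//|w /= ->].
move=> [az zy]; rewrite (_ : [set z] `&` _ = [set z])//.
by apply/seteqP; split => [w []//|w /= ->].
Qed.

Hypotheses (rhoY : product_densities Y rho) (lb_gt0 : 0 < lambda_bar rho).
Variable Palm : R.-pker (stpoint R d) ~> (config R d).
Hypothesis Palm_reduced : reduced_palm Y (intensity rho) Palm.

Lemma esum_scale n (phi : config R d) y c : 0 <= c ->
  (\esum_(v in dtuples n (atoms phi)) (c * \prod_(i < n) u y (tnth v i))%:E =
   c%:E * tuple_sum n (atoms phi) (u y))%E.
Proof.
move=> c0; have u0 := u_fun_ge0 r t rhoY lb_gt0 y.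
have [s us sP] := charged_support (u_fun_bounded rho r t y) phi.
by rewrite (tuple_sum_coef u0 n c0 us sP) (tuple_sum_charged u0 n us sP).
Qed.

(** The (n+1)-st moment of the process, with its first point singled out, is the
    n-th moment of the reduced Palm distribution at that point.  Dividing the
    test function by the intensity cancels the intensity in the Palm formula. *)
Lemma palm_moment n (A : set pt) : measurable A ->
  (\int[leb]_(y in A) \int[Palm y]_phi tuple_sum n (atoms phi) (u y) =
   \int[pm n.+1]_v (lb ^+ n * (near_head A v * rew v))%:E)%E.
Proof.
move=> mA; have lam0 := intensity_gt0 rhoY lb_gt0.
pose c y : R := \1_A y / lam y.
have c0 y : 0 <= c y by rewrite divr_ge0// ltW.
have u0 := u_fun_ge0 r t rhoY lb_gt0.
have mc : measurable_fun setT c.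
  apply: measurable_funM; first exact: measurable_indic.
  by apply: measurable_invr_ge0; [move=> y; exact/ltW|exact: (measurable_intensity rhoY)].
pose g (p : pt * config R d) : \bar R :=
  \esum_(v in dtuples n (atoms p.2)) (c p.1 * \prod_(i < n) u p.1 (tnth v i))%:E.
have g0 p : (0 <= g p)%E.
  by apply: esum_ge0 => v _; rewrite lee_fin mulr_ge0// prodr_ge0.
have mg : measurable_fun setT g.
  apply: (measurable_esum_tuples (pi := snd)
    (h := fun p => (c p.1.1 * \prod_(i < n) u p.1.1 (tnth p.2 i))%:E)).
  - exact: measurable_snd.
  - apply/measurable_EFinP; apply: measurable_funM.
      exact: (measurableT_comp mc (measurableT_comp measurable_fst measurable_fst)).
    apply: measurable_prod => i _.
    have mi : measurable_fun setT
        (fun p : pt * config R d * n.-tuple pt => (p.1.1, tnth p.2 i)).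
      apply: measurable_fun_pair.
        exact: (measurableT_comp measurable_fst measurable_fst).
      exact: (measurableT_comp (measurable_tnth i) measurable_snd).
    exact: (measurableT_comp (measurable_u_fun r t rhoY) mi).
  - by move=> p; rewrite lee_fin mulr_ge0// prodr_ge0.
have := Palm_reduced mg g0.
pose h (v : n.+1.-tuple pt) : \bar R := (c (thead v) *
  \prod_(i < n) u (thead v) (tnth [tuple of behead v] i))%:E.
have h0 v : (0 <= h v)%E by rewrite lee_fin mulr_ge0// prodr_ge0.
have mh : measurable_fun setT h.
  have mhd : measurable_fun setT (fun v : n.+1.-tuple pt => thead v).
    exact: measurable_tnth.
  apply/measurable_EFinP; apply: measurable_funM; first exact: (measurableT_comp mc mhd).
  apply: measurable_prod => i _.
  have mi : measurable_fun setT
      (fun v : n.+1.-tuple pt => (thead v, tnth [tuple of behead v] i)).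
    apply: measurable_fun_pair => //.
    exact: (measurableT_comp (measurable_tnth i) (measurable_behead (n := n))).
  exact: (measurableT_comp (measurable_u_fun r t rhoY) mi).
have -> : (\int[Pr]_w (\esum_(y in atoms (Y w)) g (y, remove_point (Y w) y)) =
    \int[Pr]_w (\esum_(v in distinct_tuples n.+1 (Y w)) h v))%E.
  apply: eq_integral => w _; rewrite [RHS]esum_dtuplesS//.
  apply: eq_esum => y _; rewrite /g/= atoms_remove_point.
  apply: eq_esum => v _; rewrite /h theadE.
  by rewrite (_ : [tuple of behead (tcons (y, v))] = v)//; exact: val_inj.
have [_ _ _ _ cam] := rhoY (ltn0Sn n).
rewrite cam// => palm.
transitivity (\int[leb]_y (\int[Palm y]_phi g (y, phi) * (lam y)%:E))%E.
  rewrite integral_mkcond; apply: eq_integral => y _.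
  rewrite /g/=; under [in RHS]eq_integral do rewrite esum_scale//.
  rewrite ge0_integralZl//; last 3 first.
  - exact: (measurable_slice y (measurable_tuple_sum_u r t rhoY lb_gt0 n)).
  - by move=> phi _; exact: tuple_sum_ge0.
  - by rewrite lee_fin.
  rewrite muleAC -EFinM /c divfK ?gt_eqF// patchE indicE.
  by case: ifPn; rewrite ?mul1e ?mul0e.
rewrite -palm; apply: eq_integral => v _; rewrite /h -EFinM; congr EFin.
case/tupleP: v => y v; rewrite theadE.
have -> : [tuple of behead [tuple of y :: v]] = v by exact: val_inj.
rewrite (prod_u_fun rho r t v y) /= /reweighted_density big_ord_recl tnth0.
under [in RHS]eq_bigr do rewrite tnthS.
rewrite /c invfM; ring.
Qed.

End palm_moments.

(** * Constancy of the moments *)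

Section translation_invariant_version.
Context {R : realType} {d : nat} {dO : measure_display} {Omega : measurableType dO}.
Variables (Pr : probability Omega R) (Y : {RV Pr >-> config R d})
  (rho xi xi' : forall n, n.-tuple (stpoint R d) -> R) (r t : R).
Local Notation pt := (stpoint R d).
Local Notation pm n := (power_measure (@leb R d) n).
Local Notation lb := (lambda_bar rho).
Local Notation lam := (intensity rho).
Local Notation rew := (reweighted_density rho).
Local Notation u := (u_fun rho r t).
Local Notation S := (cyl r t : set pt).
Local Notation RS := (psum (seqfun xi')).
Hypotheses (rhoY : product_densities Y rho) (cor : correlation_functions rho xi)
  (lb_gt0 : 0 < lambda_bar rho) (xi'_version : invariant_version xi xi').

(** The partition sums agree with the nonnegative reweighted densities almost
    everywhere only; their positive parts are nonnegative at every point, hence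
    also on null sets such as the patterns that contain the origin. *)
Definition psum_pos (s : seq pt) := Num.max (RS s) 0.
Definition psum_neg (s : seq pt) := Num.max (- RS s) 0.

Lemma psum_pos_ge0 s : 0 <= psum_pos s.
Proof. by rewrite le_max lexx orbT. Qed.

Lemma psum_neg_ge0 s : 0 <= psum_neg s.
Proof. by rewrite le_max lexx orbT. Qed.

Lemma psum_posneg s : RS s = psum_pos s - psum_neg s.
Proof.
rewrite /psum_pos /psum_neg; have [h|h] := leP (RS s) 0.
  by rewrite max_l ?oppr_ge0// sub0r opprK.
by rewrite max_r ?oppr_le0 ?(ltW h)// subr0.
Qed.

Lemma mseq_RS : mseq RS.
Proof. exact: mseq_psum (mseq_version xi'_version). Qed.

Lemma mseq_psum_pos : mseq psum_pos.
Proof. by move=> k; exact: (measurable_funrpos (mseq_RS (k := k))). Qed.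

Lemma mseq_psum_neg : mseq psum_neg.
Proof. by move=> k; exact: (measurable_funrneg (mseq_RS (k := k))). Qed.

Lemma psum_pos_shift c s : psum_pos (map (padd ^~ c) s) = psum_pos s.
Proof. by rewrite /psum_pos (psum_shift xi'_version). Qed.

Lemma psum_neg_shift c s : psum_neg (map (padd ^~ c) s) = psum_neg s.
Proof. by rewrite /psum_neg (psum_shift xi'_version). Qed.

Lemma rew_psum_pos_ae n : (0 < n)%N ->
  {ae pm n, forall v : n.-tuple pt, rew v = psum_pos v}.
Proof.
move=> n0; have := reweighted_psum_ae xi'_version cor n0; apply: filterS => v rv.
by rewrite /psum_pos -rv max_l// (reweighted_ge0 rhoY lb_gt0).
Qed.

Lemma psum_neg_ae0 n : (0 < n)%N -> {ae pm n, forall v : n.-tuple pt, psum_neg v = 0}.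
Proof.
move=> n0; have := reweighted_psum_ae xi'_version cor n0; apply: filterS => v rv.
by rewrite /psum_neg -rv max_r// oppr_le0 (reweighted_ge0 rhoY lb_gt0).
Qed.

Lemma integral_rew n (a : seq pt -> R) : (0 < n)%N -> mseq a ->
  (\int[pm n]_v (a v * rew v)%:E = \int[pm n]_v (a v * psum_pos v)%:E)%E.
Proof.
move=> n0 ma; apply: ae_eq_integral => //.
- apply/measurable_EFinP; apply: measurable_funM; first exact: ma.
  exact: (measurable_reweighted rhoY lb_gt0).
- by apply/measurable_EFinP; apply: measurable_funM; [exact: ma|exact: mseq_psum_pos].
- by have := rew_psum_pos_ae n0; apply: filterS => v rv _; rewrite rv.
Qed.

Lemma integral_psum_neg n (a : seq pt -> R) : (0 < n)%N -> mseq a ->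
  (\int[pm n]_v (a v * psum_neg v)%:E = 0)%E.
Proof.
move=> n0 ma; rewrite -[RHS](integral0 (pm n) setT); apply: ae_eq_integral => //.
- by apply/measurable_EFinP; apply: measurable_funM; [exact: ma|exact: mseq_psum_neg].
- by have := psum_neg_ae0 n0; apply: filterS => v rv _; rewrite rv mulr0.
Qed.

(** With a null negative part, the signed integral is that of the positive part.
    The points of o are held fixed: there is none for the moments of the process,
    and the origin for those of its Palm distributions. *)
Lemma integrable_psum n (o : seq pt) :
  (\int[pm n]_v (ones S v * psum_pos (o ++ v))%:E < +oo)%E ->
  (\int[pm n]_v (ones S v * psum_neg (o ++ v))%:E = 0)%E ->
  (pm n).-integrable setT (fun v => (ones S v * RS (o ++ v))%:E) /\
  (\int[pm n]_v (ones S v * psum_pos (o ++ v))%:E =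
   (\int[pm n]_v (ones S v * RS (o ++ v)))%:E)%E.
Proof.
have mo (g : seq pt -> R) : mseq g -> mseq (fun s => ones S s * g (o ++ s)).
  move=> mg k; apply: measurable_funM; first exact: (mseq_ones (measurable_cyl r t)).
  elim: o g mg => [|x o' ih] g mg; first exact: mg.
  exact: ih _ (mseq_cons x mg).
have int_ge0 (g : seq pt -> R) : mseq g -> (forall s, 0 <= g s) ->
    (\int[pm n]_v (ones S v * g (o ++ v))%:E < +oo)%E ->
    (pm n).-integrable setT (fun v => (ones S v * g (o ++ v))%:E).
  move=> mg g0 fin; apply/integrableP; split; first exact: (mseq_EFin (mo g mg) (k := n)).
  by under eq_integral do rewrite gee0_abs ?lee_fin ?mulr_ge0 ?ones_ge0//.
move=> hp hn.
have ip := int_ge0 _ mseq_psum_pos psum_pos_ge0 hp.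
have iN : (pm n).-integrable setT (fun v => (ones S v * psum_neg (o ++ v))%:E).
  by apply: int_ge0; rewrite ?hn; [exact: mseq_psum_neg|exact: psum_neg_ge0|].
have E v : (ones S v * RS (o ++ v))%:E =
    ((ones S v * psum_pos (o ++ v))%:E - (ones S v * psum_neg (o ++ v))%:E)%E.
  by rewrite -EFinB -mulrBr -psum_posneg.
split.
  apply: (eq_integrable measurableT _ _ _ (integrableB measurableT ip iN)) => v _.
  by rewrite E.
rewrite /Rintegral; under [in RHS]eq_integral do rewrite E.
by rewrite integralB// hn sube0 fineK//; exact: integrable_fin_num.
Qed.

Definition window_mass n : R := \int[pm n]_v (ones S v * RS v).

Lemma window_massP n :
  (pm n).-integrable setT (fun v => (ones S v * RS v)%:E) /\
  (\int[pm n]_v (ones S v * psum_pos v)%:E = (window_mass n)%:E)%E.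
Proof.
apply: (@integrable_psum n [::]) => /=.
  case: n => [|n].
    rewrite (@integral_power0 _ _ _ leb (fun v => (ones S v * psum_pos v)%:E)) ?ltry//.
    exact: measurable_tuple0.
  rewrite -integral_rew//; last exact: (mseq_ones (measurable_cyl r t)).
  by apply: (reweighted_moment_lty rhoY lb_gt0) => //;
    [exact: measurable_cyl|exact: bounded_cyl].
case: n => [|n]; last by apply: integral_psum_neg => //; exact: (mseq_ones (measurable_cyl r t)).
rewrite (@integral_power0 _ _ _ leb (fun v => (ones S v * psum_neg v)%:E)).
  by rewrite /psum_neg/= psum_nil max_r ?mulr0// lerN10.
exact: measurable_tuple0.
Qed.

Lemma window_mass_ge0 n : 0 <= window_mass n.
Proof.
rewrite -lee_fin -(window_massP n).2; apply: integral_ge0 => v _.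
by rewrite lee_fin mulr_ge0 ?ones_ge0 ?psum_pos_ge0.
Qed.

Lemma window_mass0 : window_mass 0 = 1.
Proof.
rewrite /window_mass /Rintegral
  (@integral_power0 _ _ _ leb (fun v => (ones S v * RS v)%:E)) /=.
  by rewrite /ones big_nil mul1r psum_nil.
exact: measurable_tuple0.
Qed.

(** Translating the window from y to the origin removes y. *)
Lemma tuple_sum_window n y :
  (\int[distribution Pr Y]_phi tuple_sum n (atoms phi) (u y) =
   (lb ^+ n * window_mass n)%:E)%E.
Proof.
case: n => [|n].
  under eq_integral do rewrite tuple_sum0.
  rewrite (integral_cst _ measurableT 1%E) mul1e expr0 window_mass0 mulr1.
  exact: (probability_setT (distribution Pr Y)).
rewrite (tuple_sum_moment r t rhoY lb_gt0)//.
have ms : measurable (cyl_at r t y).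
  rewrite -[X in measurable X]setTI.
  have := measurable_slice y measurable_psub.
  by move=> /(_ measurableT _ (measurable_cyl r t)).
have lbn : 0 <= lb ^+ n.+1 by rewrite exprn_ge0// ltW.
have mg : mseq (fun s => ones (cyl_at r t y) s * psum_pos s).
  by apply: mseq_mul; [exact: mseq_ones|exact: mseq_psum_pos].
under eq_integral do rewrite mulrA.
rewrite (integral_rew (a := fun s => lb ^+ n.+1 * ones (cyl_at r t y) s))//; last first.
  by move=> k; apply: measurable_funM => //; exact: mseq_ones.
under eq_integral do rewrite -mulrA EFinM.
rewrite ge0_integralZl//; last 2 first.
- exact: (mseq_EFin mg (k := n.+1)).
- by move=> v _; rewrite lee_fin mulr_ge0 ?ones_ge0 ?psum_pos_ge0.
rewrite EFinM; congr (_ * _)%E; rewrite -(window_massP _).2.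
rewrite -(integral_tshift y
  (g := fun v : n.+1.-tuple pt => (ones (cyl_at r t y) v * psum_pos v)%:E)); last 2 first.
- exact: (mseq_EFin mg (k := n.+1)).
- by move=> v; rewrite lee_fin mulr_ge0 ?ones_ge0 ?psum_pos_ge0.
apply: eq_integral => v _; rewrite val_tshift psum_pos_shift.
by rewrite ones_cyl_at_shift.
Qed.

Definition palm_mass n : R := \int[pm n]_v (ones S v * RS (origin :: v)).

Lemma near_head_le (A : set pt) : bounded A -> exists B : set pt,
  [/\ measurable B, bounded B & forall s, near_head r t A s <= ones B s].
Proof.
move=> [N AN]; have [M HM] := @cyl_psub_bounded R d N N r t.
exists (cyl (Num.max M N) (Num.max M N)); split.
- exact: measurable_cyl.
- exact: bounded_cyl.
case=> [|y s] /=; first exact: ones_ge0.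
rewrite ones_cons !indicE; have [/[!inE] Ay|_] := boolP (y \in A); last first.
  by rewrite mul0r mulr_ge0 ?ones_ge0.
rewrite [X in _ <= X * _](_ : _ = 1); last first.
  by rewrite mem_set//; apply: (cyl_mono (M := N)); [rewrite le_max lexx orbT|exact: AN].
rewrite !mul1r /ones; apply: ler_prod => z _; rewrite ler0n/= !indicE ler_nat.
have [/[!inE] zy|//] := boolP (z \in cyl_at _ _ _).
rewrite mem_set//; apply: (cyl_mono (M := M)); first by rewrite le_max lexx.
by apply: HM zy; exact: AN.
Qed.

(** Averaging the position of the first point over a set of measure 1 turns the
    integral with that point at the origin into an integral of the reweighted
    density itself, of which the almost everywhere identities hold. *)
Lemma palm_massP n :
  (pm n).-integrable setT (fun v => (ones S v * RS (origin :: v))%:E) /\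
  (\int[pm n]_v (ones S v * psum_pos (origin :: v))%:E = (palm_mass n)%:E)%E.
Proof.
have [A mA [bA A1]] := @leb_unit_box R d.
have [B [mB bB AB]] := near_head_le bA.
have mh := mseq_near_head r t mA.
have slice h := integral_near_head r t n (h := h) mA.
have E h : leb A = 1%E -> (leb A * h = h)%E by move=> ->; rewrite mul1e.
apply: (@integrable_psum n [:: origin]) => /=.
  have := slice _ mseq_psum_pos psum_pos_ge0 (fun c x s => psum_pos_shift c (x :: s)).
  rewrite E// => <-; rewrite -integral_rew//.
  apply: le_lt_trans (reweighted_moment_lty rhoY lb_gt0 (ltn0Sn n) mB bB).
  have mr := measurable_reweighted rhoY lb_gt0 (ltn0Sn n).
  apply: ge0_le_integral => //.
  - move=> v _; rewrite lee_fin mulr_ge0 ?near_head_ge0//.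
    exact: (reweighted_ge0 rhoY lb_gt0).
  - by apply/measurable_EFinP; apply: measurable_funM => //; exact: mh.
  - by apply/measurable_EFinP; apply: measurable_funM => //; exact: mseq_ones.
  - move=> v _; rewrite lee_fin ler_wpM2r//.
    exact: (reweighted_ge0 rhoY lb_gt0).
have := slice _ mseq_psum_neg psum_neg_ge0 (fun c x s => psum_neg_shift c (x :: s)).
by rewrite E// => <-; exact: integral_psum_neg.
Qed.

Variable Palm : R.-pker (stpoint R d) ~> (config R d).
Hypothesis Palm_reduced : reduced_palm Y (intensity rho) Palm.

Lemma palm_mass_ge0 n : 0 <= palm_mass n.
Proof.
rewrite -lee_fin -(palm_massP n).2; apply: integral_ge0 => v _.
by rewrite lee_fin mulr_ge0 ?ones_ge0 ?psum_pos_ge0.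
Qed.

(** Both sides have the same integral over every measurable set of positions. *)
Lemma tuple_sum_palm : {ae leb, forall y, forall n,
  (\int[Palm y]_phi tuple_sum n (atoms phi) (u y) = (lb ^+ n * palm_mass n)%:E)%E}.
Proof.
apply: ae_foralln => n.
pose F y := (\int[Palm y]_phi tuple_sum n (atoms phi) (u y))%E.
have mF : measurable_fun setT F.
  apply: (measurable_fun_integral_sfinite_kernel
    (fun p => tuple_sum n (atoms p.2) (u p.1)) Palm).
    by move=> p; apply: tuple_sum_ge0; exact: (u_fun_ge0 r t rhoY lb_gt0).
  exact: (measurable_tuple_sum_u r t rhoY lb_gt0).
have lbn : 0 <= lb ^+ n by rewrite exprn_ge0// ltW.
have FA A : measurable A -> (\int[leb]_(y in A) F y =
    \int[leb]_(y in A) (lb ^+ n * palm_mass n)%:E)%E.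
  move=> mA; rewrite (palm_moment r t rhoY lb_gt0 Palm_reduced)//.
  have mh := mseq_near_head r t mA.
  under eq_integral do rewrite mulrA.
  rewrite (integral_rew (a := fun s => lb ^+ n * near_head r t A s))//; last first.
    by move=> k; apply: measurable_funM => //; exact: mh.
  under eq_integral do rewrite -mulrA EFinM.
  rewrite ge0_integralZl//; last 2 first.
  - exact: (mseq_EFin (mseq_mul mh mseq_psum_pos) (k := n.+1)).
  - by move=> v _; rewrite lee_fin mulr_ge0 ?near_head_ge0 ?psum_pos_ge0.
  rewrite (integral_near_head r t n mA mseq_psum_pos psum_pos_ge0); last first.
    by move=> c x s; exact: psum_pos_shift.
  rewrite (palm_massP n).2 (integral_cst _ mA (lb ^+ n * palm_mass n)%:E).
  by rewrite EFinM muleCA muleC.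
have [D DT Doo] := sigma_finiteT (@leb R d).
have aeD k : {ae leb, forall y, D k y -> F y = (lb ^+ n * palm_mass n)%:E}.
  have [mD Dk] := Doo k.
  have := @integral_ae_eq _ _ _ (@leb R d) (D k) mD F (cst (lb ^+ n * palm_mass n)%:E).
  move=> h; have {}h := h _ (measurable_funTS mF) _.
  have h' : ae_eq leb (D k) (cst (lb ^+ n * palm_mass n)%:E) F.
    apply: h.
      apply/integrableP; split; first exact: measurable_cst.
      rewrite (integral_cst _ mD `|(lb ^+ n * palm_mass n)%:E|%E).
      by rewrite lte_mul_pinfty.
    by move=> E ED mE; rewrite FA.
  by apply: filterS h' => y hy Dy; rewrite -hy.
have := ae_foralln aeD; apply: filterS => y hy.
have [k _ Dy] : (\bigcup_k D k) y by rewrite -DT.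
exact: (hy k Dy).
Qed.

End translation_invariant_version.

(** * Expansion along the block of the origin *)

Section palm_expansion.
Context {R : realType} {d : nat} {dO : measure_display} {Omega : measurableType dO}.
Variables (Pr : probability Omega R) (Y : {RV Pr >-> config R d})
  (rho xi xi' : forall n, n.-tuple (stpoint R d) -> R) (r t : R).
Local Notation pt := (stpoint R d).
Local Notation pm n := (power_measure (@leb R d) n).
Local Notation S := (cyl r t : set pt).
Local Notation RS := (psum (seqfun xi')).
Hypotheses (rhoY : product_densities Y rho) (cor : correlation_functions rho xi)
  (lb_gt0 : 0 < lambda_bar rho) (xi'_version : invariant_version xi xi').

Let corr (s : seq pt) : R := ones S s * seqfun xi' (origin :: s).
Let dens (s : seq pt) : R := ones S s * RS s.

Definition corr_mass n : R := \int[pm n]_v corr v.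

(** In terms of masks: the mask selects the companions of the origin in its block. *)
Lemma psum_origin n (v : n.-tuple pt) : ones S v * RS (origin :: v) =
  \sum_(m : n.-tuple bool) corr (mask m v) * dens (mask (map negb m) v).
Proof.
rewrite (@psum_cons _ _ _ _ _ n) ?size_tuple// mulr_sumr; apply: eq_bigr => m _.
rewrite (@ones_mask _ _ _ m) ?size_tuple// /corr /dens; ring.
Qed.

Let mseq_corr : mseq corr.
Proof.
apply: mseq_mul; first exact: (mseq_ones (measurable_cyl r t)).
exact: mseq_cons (mseq_version xi'_version).
Qed.

Let mseq_dens : mseq dens.
Proof.
apply: mseq_mul; first exact: (mseq_ones (measurable_cyl r t)).
exact: mseq_RS xi'_version.
Qed.

Let integrable_dens n : (pm n).-integrable setT (fun v => (dens v)%:E).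
Proof. exact: (window_massP r t rhoY cor lb_gt0 xi'_version n).1. Qed.

(** The block of the origin that exhausts the window contributes the correlation
    function itself; every other term has lower order. *)
Lemma integrable_corr n : (pm n).-integrable setT (fun v => (corr v)%:E).
Proof.
have [k] := ubnP n; elim: k n => // k ih n nk.
pose top : n.-tuple bool := nseq_tuple n true.
have top_unique (m : n.-tuple bool) : m != top -> (count id m < n)%N.
  move=> mt; rewrite ltn_neqAle -[X in (_ <= X)%N](size_tuple m) count_size andbT.
  apply: contra mt => /eqP cm; apply/eqP/val_inj => /=.
  have /all_pred1P -> : all (pred1 true) m.
    by rewrite all_count (eq_count (a2 := id)) ?cm ?size_tuple// => -[].
  by rewrite size_tuple.
have ip := (palm_massP r t rhoY cor lb_gt0 xi'_version n).1.
have im m : m != top ->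
    (pm n).-integrable setT (fun v => (corr (mask m v) * dens (mask (map negb m) v))%:E).
  move=> mt; apply: integrable_mask => //; first by rewrite size_tuple.
  by apply: ih; rewrite (leq_trans (top_unique m mt))// -ltnS.
have isum : (pm n).-integrable setT (fun v => (\sum_(m : n.-tuple bool | m != top)
    (corr (mask m v) * dens (mask (map negb m) v))%:E)%E).
  exact: (integrable_sum measurableT (index_enum _) (P := fun m => m != top) im).
apply: (eq_integrable measurableT _ _ _ (integrableB measurableT ip isum)) => v _.
rewrite psum_origin (bigD1 top)//= sumEFin -EFinB addrK.
have -> : map negb (nseq n true) = nseq n false by rewrite map_nseq.
rewrite mask_false mask_true ?size_tuple//.
by rewrite /dens /ones big_nil psum_nil !mulr1.
Qed.

(** The binomial convolution behind the product of the two exponential series. *)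
Lemma palm_mass_expansion n : palm_mass xi' r t n =
  \sum_(k < n.+1) 'C(n, k)%:R * (corr_mass k * window_mass xi' r t (n - k)).
Proof.
rewrite -(sum_masks n (fun k l => corr_mass k * window_mass xi' r t l)).
rewrite /palm_mass; under eq_Rintegral do rewrite psum_origin.
have im (m : n.-tuple bool) : (pm n).-integrable setT
    (fun v => (corr (mask m v) * dens (mask (map negb m) v))%:E).
  apply: integrable_mask => //; first by rewrite size_tuple.
  exact: integrable_corr.
rewrite /Rintegral; under eq_integral do rewrite -sumEFin.
rewrite integral_sum//.
rewrite (eq_bigr (fun m : n.-tuple bool =>
  (corr_mass (count id m) * window_mass xi' r t (count negb m))%:E)); last first.
  move=> m _.
  rewrite -[LHS]fineK; last exact: integrable_fin_num.
  congr EFin; apply: (Rintegral_mask mseq_corr mseq_dens); rewrite ?size_tuple//.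
  exact: integrable_corr.
by rewrite sumEFin.
Qed.

Lemma corr_mass_J n : corr_mass n = J_ xi' n r t.
Proof.
rewrite /J_ Rintegral_mkcond; apply: eq_Rintegral => v _.
rewrite /corr ones_tpow patchE indicE.
have -> : seqfun xi' (origin :: v) = @xi' n.+1 [tuple of origin :: v] by rewrite -seqfunE.
by case: ifPn; rewrite ?mul1r ?mul0r.
Qed.

(** By invariance xi' 1 is constant; a constant that equals 1 almost everywhere
    is 1, as the space has positive measure. *)
Lemma xi'_origin : seqfun xi' [:: origin] = 1.
Proof.
have [_ inv ae1] := xi'_version (ltn0Sn 0); have [xi1 _] := cor.
apply: contrapT => ne.
have ne1 (v : 1.-tuple pt) : @xi' 1 v <> 1.
  move=> v1; apply: ne.
  have := inv [tuple (origin : pt)] (thead v).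
  rewrite -!seqfunE val_tshift /= padd_origin => <-.
  rewrite -[RHS]v1 -seqfunE; congr (seqfun _ _).
  by case: v {v1} => -[|x []]//= sz; rewrite /thead (tnth_nth x).
have [A mA [bA A1]] := @leb_unit_box R d.
have null : pm 1 setT = 0%E.
  have [N [mN N0 subN]] := ae1; rewrite -N0; congr (pm 1 _).
  apply/seteqP; split => // v _; apply: subN => /= h; apply: (ne1 v).
  by rewrite h xi1.
have /eqP := null; rewrite gt_eqF//.
have -> : pm 1 setT = @leb R d setT.
  have := @integral_powerS _ _ _ (@leb R d) 0 (cst 1%E) (measurable_cst _) (fun=> lee01).
  rewrite integral_cst// mul1e => ->.
  rewrite -[RHS]mul1e -(integral_cst (@leb R d) measurableT 1%E).
  apply: eq_integral => y _.
  by rewrite (@integral_power0 _ _ _ leb (fun v => cst 1%E (tcons (y, v)))).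
apply: (@lt_le_trans _ _ (leb A)); first by rewrite A1.
by apply: le_measure; rewrite ?inE.
Qed.

Lemma corr_mass0 : corr_mass 0 = 1.
Proof.
rewrite /corr_mass /Rintegral (@integral_power0 _ _ _ leb (fun v => (corr v)%:E)) /=.
  by rewrite /corr /ones big_nil mul1r; exact: xi'_origin.
exact: measurable_tuple0.
Qed.

End palm_expansion.

(** * The product formula *)

Theorem theorem1 (R : realType) (d : nat) (d_gt0 : (0 < d)%N)
  (dO : measure_display) (Omega : measurableType dO)
  (Pr : probability Omega R) (Y : {RV Pr >-> config R d}) (Y_stpp : STPP Y)
  (rho xi xi' : forall n, n.-tuple (stpoint R d) -> R)
  (Y_irms : IRMS Y rho xi) (xi'_version : invariant_version xi xi')
  (Palm : R.-pker (stpoint R d) ~> (config R d))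
  (Palm_reduced : reduced_palm Y (intensity rho) Palm)
  (r t : R) (r_ge0 : 0 <= r) (t_ge0 : 0 <= t)
  (J_def : J_defined rho xi' r t)
  (limsup_lt1 :
    (limn_esup (fun n : nat =>
       ((lambda_bar rho ^+ n / n`!%:R)%:E *
        \int[power_measure leb n]_(v in tpow (cyl r t))
          (reweighted_density rho v)%:E) `^ (n%:R^-1)) < 1)%E) :
  exists G F : R,
    [/\ {ae leb, forall y, G_inhom rho Palm r t y = G},
        {ae leb, forall y, F_inhom rho Y r t y = F} &
        F <> 1 -> J_inhom rho xi' r t = (1 - G) / (1 - F)].
Proof.
have [rhoY cor lb_gt0 _] := Y_irms.
pose lb := lambda_bar rho.
have lb_ge0 n : 0 <= lb ^+ n by rewrite exprn_ge0// ltW.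
pose a k : R := (- lb) ^+ k / k`!%:R * corr_mass xi' r t k.
pose b k : R := (- lb) ^+ k / k`!%:R * window_mass xi' r t k.
have wm := window_massP r t rhoY cor lb_gt0 xi'_version.
have wm_ge0 := window_mass_ge0 r t rhoY cor lb_gt0 xi'_version.
have pm_ge0 := palm_mass_ge0 r t rhoY cor lb_gt0 xi'_version.
have fact_ge0 n : 0 <= (n`!%:R : R)^-1 by rewrite invr_ge0.
have normb n : `|b n| = lb ^+ n * window_mass xi' r t n / n`!%:R.
  rewrite /b !normrM normrX normrN normfV !ger0_norm ?(ltW lb_gt0)//.
  by rewrite mulrAC.
(* |b n| is the n-th term of the assumption on the limsup *)
have cvg_b : cvgn (series (fun n => `|b n|)).
  apply: (root_test _ _ limsup_lt1) => [n n0|n]; last exact: normr_ge0.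
  rewrite normb mulrAC [RHS]EFinM; congr (_ * _)%E; rewrite -(wm n).2.
  rewrite -(integral_rew rhoY cor lb_gt0 xi'_version)//; last first.
    exact: (mseq_ones (measurable_cyl r t)).
  rewrite integral_mkcond; apply: eq_integral => v _.
  by rewrite patchE ones_tpow indicE; case: ifPn; rewrite ?mul1r ?mul0r.
have a0 : a 0%N = 1.
  by rewrite /a expr0 fact0 divr1 mul1r (corr_mass0 r t cor xi'_version).
have aJ k : a k.+1 = J_term rho xi' r t k by rewrite /a /J_term corr_mass_J.
have cvg_a : cvgn (series (fun n => `|a n|)).
  have /cvg_ex[l hl] : cvgn (series (fun n => `|a n.+1|)).
    by under eq_fun do rewrite aJ; exact: J_def.
  by apply/cvg_ex; eexists; apply: cvg_series_shift hl.
have lim_a : limn (series a) = J_inhom rho xi' r t.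
  have hJ : series (fun n => a n.+1) @ \oo --> limn (series (J_term rho xi' r t)).
    rewrite (_ : (fun n => a n.+1) = J_term rho xi' r t); last exact/funext.
    exact: normed_cvg J_def.
  by rewrite (cvg_lim _ (cvg_series_shift hJ))// a0.
pose L := limn (series a) * limn (series b).
have cvg_c : series (cauchy_product a b) @ \oo --> L 
  by exact: cauchy_product_cvg cvg_a cvg_b.
have cE n : cauchy_product a b n =
    (-1) ^+ n * (lb ^+ n * palm_mass xi' r t n / n`!%:R).
  rewrite (palm_mass_expansion r t rhoY cor lb_gt0 xi'_version) !mulr_sumr mulr_suml mulr_sumr.
  apply: eq_bigr => k _; rewrite /a /b.
  have kn : (k <= n)%N by rewrite -ltnS.
  have nf : (n`!%:R : R) != 0 by rewrite pnatr_eq0 -lt0n fact_gt0.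
  have kf : (k`!%:R : R) != 0 by rewrite pnatr_eq0 -lt0n fact_gt0.
  have nkf : ((n - k)`!%:R : R) != 0 by rewrite pnatr_eq0 -lt0n fact_gt0.
  have binE : 'C(n, k)%:R / n`!%:R = (k`!%:R)^-1 * ((n - k)`!%:R)^-1 :> R.
    by rewrite -(bin_fact kn) !natrM; field; rewrite kf nkf pnatr_eq0 -lt0n bin_gt0 kn.
  have lbE : (- lb) ^+ k * (- lb) ^+ (n - k) = (-1) ^+ n * lb ^+ n.
    by rewrite -exprD subnKC// -exprMn mulN1r.
  transitivity (((- lb) ^+ k * (- lb) ^+ (n - k)) * ((k`!%:R)^-1 * ((n - k)`!%:R)^-1) *
      (corr_mass xi' r t k * window_mass xi' r t (n - k))); first by ring.
  by rewrite lbE -binE; ring.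
exists (1 - L), (1 - limn (series b)); split.
- have := tuple_sum_palm r t rhoY cor lb_gt0 xi'_version Palm_reduced.
  apply: filterS => y Qm; rewrite /G_inhom; congr (1 - _); apply/esym.
  have mu := measurable_slice y (measurable_u_fun r t rhoY).
  have u0 := u_fun_ge0 r t rhoY lb_gt0 y.
  have fin : (\sum_(n <oo) (lb ^+ n * palm_mass xi' r t n / n`!%:R)%:E < +oo)%E.
    apply: nneseries_lty => [n|]; first by rewrite mulr_ge0// mulr_ge0.
    (* the Cauchy product of the absolute values dominates *)
    apply: (@series_le_cvg _ _ (cauchy_product (fun n => `|a n|) (fun n => `|b n|))).
    + by move=> n; rewrite mulr_ge0// mulr_ge0.
    + exact: cauchy_product_ge0.
    + move=> n; have -> : lb ^+ n * palm_mass xi' r t n / n`!%:R = `|cauchy_product a b n|.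
        by rewrite cE normrM normrX normrN1 expr1n mul1r ger0_norm// mulr_ge0// mulr_ge0.
      apply: le_trans (ler_norm_sum _ _ _) _; apply: ler_sum => k _.
      by rewrite normrM.
    + apply/cvg_ex; eexists.
      exact: (cauchy_product_cvg_ge0 (fun n => normr_ge0 (a n)) (fun n => normr_ge0 (b n))
        cvg_a cvg_b).
  have := generating_functional_series mu u0 (u_fun_bounded rho r t y) Qm fin.
  have -> : (fun n => (-1) ^+ n * (lb ^+ n * palm_mass xi' r t n / n`!%:R)) =
      cauchy_product a b by apply/funext => n; rewrite cE.
  by move=> h; apply: cvg_unique cvg_c h.
- apply: aeW => y; rewrite /F_inhom; congr (1 - _); apply/esym.
  have mu := measurable_slice y (measurable_u_fun r t rhoY).
  have u0 := u_fun_ge0 r t rhoY lb_gt0 y.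
  have Qm n := tuple_sum_window r t rhoY cor lb_gt0 xi'_version n y.
  have fin : (\sum_(n <oo) (lb ^+ n * window_mass xi' r t n / n`!%:R)%:E < +oo)%E.
    apply: nneseries_lty => [n|]; first by rewrite mulr_ge0// mulr_ge0.
    rewrite (_ : (fun _ => _) = (fun n => `|b n|)); first exact: cvg_b.
    by apply/funext => n; rewrite normb.
  have := generating_functional_series mu u0 (u_fun_bounded rho r t y) Qm fin.
  have -> : (fun n => (-1) ^+ n * (lb ^+ n * window_mass xi' r t n / n`!%:R)) = b.
    apply/funext => n; rewrite /b [in RHS]exprNn -!mulrA; do 2!congr (_ * _); exact: mulrC.
  by move=> /cvg_lim; apply.
- rewrite !subKr => F1.
  rewrite /L lim_a mulfK//; apply/eqP => b0; apply: F1.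
  by rewrite b0 subr0.
Qed.
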